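(* Let $G$ be a connected graph with $n$ vertices and exactly $k$ cut vertices, and let $0\le\alpha<1$. Then $\rho_{\alpha}(G)\le\rho_{\alpha}(G_{n,k})$, with equality if and only if $G\cong G_{n,k}$.
   Context: For a graph $H$ with adjacency matrix $A(H)$ and diagonal degree matrix $D(H)$, and $\alpha\in[0,1]$, define $A_{\alpha}(H)=\alpha D(H)+(1-\alpha)A(H)$, and let $\rho_{\alpha}(H)$ denote the spectral radius of $A_{\alpha}(H)$. A cut vertex of a connected graph is a vertex whose deletion disconnects the graph. $G_{n,k}$ is the graph obtained from the complete graph $K_{n-k}$ by attaching pendent paths of almost equal lengths to all vertices of $K_{n-k}$: to the $i$-th vertex of $K_{n-k}$ one attaches a pendent path with $\ell_i\ge 0$ new vertices, where $\ell_1+\cdots+\ell_{n-k}=k$ and $|\ell_i-\ell_j|\le 1$ for all $i,j$ (a pendent path with $\ell$ new vertices attached at $x$ consists of new vertices $y_1,\dots,y_\ell$ with edges $y_1y_2,\dots,y_{\ell-1}y_\ell,y_\ell x$). *)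

(* Defs.v *)
(* MathComp world; the real numbers are an arbitrary [R : realType]. *)
From HB Require Import structures.
From mathcomp Require Import all_boot all_order all_algebra.
From mathcomp Require Import classical_sets reals.
From mathcomp Require Import complex.

Set Implicit Arguments.
Unset Strict Implicit.
Unset Printing Implicit Defensive.

Import Order.TTheory GRing.Theory Num.Theory.
Local Open Scope ring_scope.

Record sgraph := SGraph {
  vertex :> finType;
  adj : rel vertex;
  adj_sym : symmetric adj;
  adj_irrefl : irreflexive adj }.

Definition isomorphic (G H : sgraph) : Prop :=
  exists f : G -> H,
    bijective f /\ forall x y : G, adj (f x) (f y) = adj x y.

(* The null graph is neither connected nor disconnected, so the vertex of the
   one-vertex graph is not a cut vertex. *)
Definition disconnected_graph (G : sgraph) : bool :=
  [exists x : G, exists y : G, ~~ connect (@adj G) x y].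

Definition connected_graph (G : sgraph) : bool :=
  (0 < #|G|)%N && ~~ disconnected_graph G.

Section Deletion.
Variables (G : sgraph) (v : G).

Definition del_adj : rel {x : G | x != v} := fun x y => adj (val x) (val y).

Lemma del_adj_sym : symmetric del_adj.
Proof. by move=> x y; exact: adj_sym. Qed.

Lemma del_adj_irrefl : irreflexive del_adj.
Proof. by move=> x; exact: adj_irrefl. Qed.

Definition delete_vertex : sgraph := SGraph del_adj_sym del_adj_irrefl.

End Deletion.

Definition cut_vertices (G : sgraph) : {set G} :=
  [set v | disconnected_graph (delete_vertex v)].

Section PathsOnClique.
Variables (m : nat) (l : 'I_m -> nat).

(* The pair (i, 0) is the i-th vertex of K_m; for 0 < j <= l i, the pair
   (i, j) is the vertex at distance j from it on its pendent path, i.e. the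
   vertices y_(l i), ..., y_1 are (i, 1), ..., (i, l i). *)
Definition pc_vertex : Type := {i : 'I_m & 'I_(l i).+1}.

Definition pc_adj : rel pc_vertex := fun u v =>
  let a : nat := tagged u in
  let b : nat := tagged v in
  if tag u == tag v then (a == b.+1) || (b == a.+1)
  else (a == 0%N) && (b == 0%N).

Lemma pc_adj_sym : symmetric pc_adj.
Proof. by move=> u v; rewrite /pc_adj eq_sym orbC andbC. Qed.

Lemma pc_adj_irrefl : irreflexive pc_adj.
Proof. by move=> u; rewrite /pc_adj eqxx orbb; elim: (nat_of_ord _). Qed.

Definition paths_on_clique : sgraph := SGraph pc_adj_sym pc_adj_irrefl.

End PathsOnClique.

(* For [balanced k l] with [l : 'I_(n - k) -> nat], the graph
   [paths_on_clique l] is G_(n,k); its isomorphism class does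
   not depend on the choice of [l].  *)
Definition balanced (k m : nat) (l : 'I_m -> nat) : Prop :=
  (\sum_i l i = k)%N /\ forall i j, `|(l i)%:Z - (l j)%:Z| <= 1.

Lemma balanced_exists (k m : nat) :
  (0 < m)%N -> exists l : 'I_m -> nat, balanced k l.
Proof.
move=> m_gt0; exists (fun i => k %/ m + (i < k %% m))%N; split; last first.
  move=> i j; rewrite !PoszD opprD addrACA subrr add0r.
  by case: (_ < _)%N; case: (_ < _)%N.
rewrite big_split /= sum_nat_const card_ord mulnC [RHS](divn_eq k m).
congr addn; rewrite -(big_mkord xpredT (fun i => nat_of_bool (i < k %% m)%N)).
have lt_km : (k %% m <= m)%N by rewrite ltnW // ltn_pmod.
rewrite (big_cat_nat (leq0n _) lt_km) //= big_nat_cond.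
rewrite (eq_bigr (fun=> 1%N)); last first.
  by move=> i /andP[/andP[_ ->]].
rewrite -big_nat_cond sum_nat_const_nat subn0 muln1 big_nat_cond big1 ?addn0 //.
by move=> i /andP[/andP[le_i _] _]; rewrite ltnNge le_i.
Qed.

Section Spectrum.
Variable R : realType.
Local Open Scope classical_set_scope.

(* Eigenvalues are complex; for 0 < p their moduli form a nonempty finite set,
   so the supremum is a maximum. *)
Definition spectral_radius (p : nat) (M : 'M[R]_p) : R :=
  sup [set Normc.normc z
      | z in [set z : R[i] | eigenvalue (map_mx (real_complex R) M) z]].

Variable G : sgraph.

Definition degree (x : G) : nat := #|[set y : G | adj x y]%SET|.

Definition adjacency_mx : 'M[R]_#|G| :=
  \matrix_(i, j) (adj (enum_val i) (enum_val j))%:R.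

Definition degree_mx : 'M[R]_#|G| :=
  diag_mx (\row_i (degree (enum_val i))%:R).

Definition alpha_mx (alpha : R) : 'M[R]_#|G| :=
  alpha *: degree_mx + (1 - alpha) *: adjacency_mx.

Definition alpha_radius (alpha : R) : R := spectral_radius (alpha_mx alpha).

End Spectrum.

(* Main.v *)
(** Let [m = n - k].  Rooting [G] at a vertex that is not a cut vertex, let the
   parent of [v] be the cut vertex nearest to [v] among those separating it from
   the root (or the root).  Adjacent vertices are siblings or parent and child,
   so the edges of [G] are covered by the blocks formed by a vertex and its
   children; every vertex lies in at most two blocks, the blocks hang together
   as a tree, and, as every cut vertex has a child, their sizes [b] satisfy
   [sum (b - 2) <= m - 2].  This bounds, for all [I] contained in [J], the number
   of edges between [I] and [J] by its value [star_count m |I| |J|] for initial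
   segments in the graph on [0 .. n - 1] where [a] and [b] are adjacent iff both
   are below [m] or they differ by [m].  That graph is a copy of [G_(n,k)]: the
   residues modulo [m] are its paths.

   Sorting the Perron vector of [G] decreasingly and summing by parts twice, the
   edge bounds give [x^T A(G) x <= y^T A(G_(n,k)) y] for the sorted vector [y],
   hence the inequality.  In case of equality [y] is an eigenvector for
   [G_(n,k)]; if [m > 2] it strictly drops at each multiple of [m], so the edge
   bounds are attained on the corresponding initial segments, and this
   determines [G].  If [m = 2], the graph [G] is a path. *)
Require Import Defs.
From HB Require Import structures.
From mathcomp Require Import classical_sets.
From mathcomp Require Import all_boot all_order all_algebra all_fingroup.
From mathcomp Require Import reals complex.
From mathcomp Require Import zify ring lra.

Set Implicit Arguments.
Unset Strict Implicit.
Unset Printing Implicit Defensive.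

Import Order.TTheory GRing.Theory Num.Theory.

(** * Edge counts in a tree of blocks *)

(** Ordered pairs are counted, so an edge with both ends in both sets counts twice. *)
Definition edge_count (G : sgraph) (I J : {set G}) : nat :=
  \sum_(u in I) #|[set v in J | adj u v]|.

(** For [i <= j] this counts adjacent ordered pairs between the first [i] and the first [j] vertices
    of the extremal graph. Over the vertices [a < i], the summands count the neighbours in the
    clique, the neighbour [a + m] and the neighbour [a - m]. *)
Definition star_count (m i j : nat) : nat :=
  minn i m * (minn j m).-1 + minn i (j - m) + (i - m).

Section BlockBound.
Variables (G : sgraph) (r : G) (p : G -> G) (m : nat).

Hypothesis p_root : p r = r.
(** Well-foundedness of the parent map: a nonempty set closed under [p] contains the root. *)
Hypothesis p_rooted : forall J : {set G}, J != set0 -> r \notin J ->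
  exists2 v, v \in J & p v \notin J.
Hypothesis p_adj : forall u v : G, adj u v -> [|| p u == v, p v == u | p u == p v].

(** The condition [v != r] keeps the root, a fixed point of [p], from being its own child. *)
Definition children c : {set G} := [set v | (v != r) && (p v == c)].
Definition inner : {set G} := [set p v | v in [set~ r]].
Definition block c : {set G} := c |: children c.

(** With [m = n - k] this says that at least [k + 1] vertices have children. *)
Hypothesis inner_card : (#|G|.+1 <= m + #|inner|)%N.

Lemma parent_neq v : v != r -> p v != v.
Proof.
move=> v_r; apply/eqP => pv.
have v_neq0 : [set v] != set0 by apply/set0Pn; exists v; rewrite inE.
have [|w] := p_rooted v_neq0; first by rewrite inE eq_sym.
by rewrite inE => /eqP->; rewrite pv inE eqxx.
Qed.

Lemma card_block_le (J : {set G}) c :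
  (#|J :&: block c| <= (c \in J) + #|J :&: children c|)%N.
Proof.
rewrite /block setIUr (leq_trans (leq_card_setU _ _)) // leq_add2r.
case: (boolP (c \in J)) => cJ /=.
  by rewrite -(cards1 c) subset_leq_card // subsetIr.
by rewrite leqn0 cards_eq0 setI_eq0 disjoint_sym disjoints1.
Qed.

Lemma card_block c : #|block c| = #|children c|.+1.
Proof.
rewrite /block cardsU1 inE.
have [->//|c_r] := eqVneq c r.
by rewrite (negPf (parent_neq c_r)) andbF.
Qed.

Lemma children_gt0 c : c \in inner -> (0 < #|children c|)%N.
Proof.
case/imsetP=> v; rewrite !inE => v_r ->.
by apply/card_gt0P; exists v; rewrite inE v_r eqxx.
Qed.

Lemma sum_children (J : {set G}) :
  (\sum_(c in inner) #|J :&: children c| = #|J :\ r|)%N.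
Proof.
rewrite -sum1_card [RHS](partition_big p (mem inner)) /=; last first.
  by move=> v; rewrite !inE => /andP[v_r _]; apply: imset_f; rewrite !inE.
apply: eq_bigr => c _; rewrite -sum1_card; apply: eq_bigl => v.
by rewrite !inE andbCA andbA.
Qed.

(** Every vertex of [J] other than the root is counted once, as a child. If the root is outside [J],
    one unit is saved at the block of a vertex [v] of [J] whose parent is not in [J]. *)
Lemma sum_block_pred (J : {set G}) : J != set0 ->
  (\sum_(c in inner) #|J :&: block c|.-1 <= #|J|.-1)%N.
Proof.
move=> J_neq0.
have le_c c : (#|J :&: block c|.-1 <= #|J :&: children c|)%N.
  by have := card_block_le J c; case: (c \in J) => /=; lia.
have [rJ|rJ] := boolP (r \in J).
  rewrite (cardsD1 r J) rJ /= -sum_children.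
  by apply: leq_sum => c _; exact: le_c.
have [v vJ pvJ] := p_rooted J_neq0 rJ.
have v_r : v != r by apply: contraNneq rJ => <-.
have pv_inner : p v \in inner by apply: imset_f; rewrite !inE.
have := sum_children J; rewrite (cardsD1 r J) (negPf rJ) add0n => <-.
rewrite (bigD1 (p v)) //= [X in (_ <= X.-1)%N](bigD1 (p v)) //=.
have : (0 < #|J :&: children (p v)|)%N.
  by apply/card_gt0P; exists v; rewrite !inE vJ v_r eqxx.
have := card_block_le J (p v); rewrite (negPf pvJ) add0n.
have : (\sum_(i in inner | i != p v) #|J :&: block i|.-1 <=
  \sum_(i in inner | i != p v) #|J :&: children i|)%N.
  by apply: leq_sum => c _; exact: le_c.
lia.
Qed.

(** A vertex lies in at most two blocks, once as the centre and once as a child. *)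
Lemma sum_block (I : {set G}) :
  (\sum_(c in inner) #|I :&: block c| <= 2 * #|I|)%N.
Proof.
apply: (@leq_trans (\sum_(c in inner) ((c \in I) + #|I :&: children c|))).
  by apply: leq_sum => c _; exact: card_block_le.
rewrite big_split /= sum_children mul2n -addnn leq_add //; last first.
  by rewrite subset_leq_card // subsetDl.
rewrite -big_mkcondr /= sum1_card subset_leq_card //.
by apply/subsetP => c; rewrite unfold_in => /andP[].
Qed.

Lemma adj_block (u v : G) : adj u v ->
  exists2 c, c \in inner & (u \in block c) && (v \in block c).
Proof.
move=> uv; have uv_neq : u != v by apply: contraTneq uv => ->; rewrite adj_irrefl.
have innerP w : w != r -> p w \in inner by move=> ?; apply: imset_f; rewrite !inE.
case/or3P: (p_adj uv) => /eqP E.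
- have u_r : u != r by apply: contra_neq uv_neq => u_r; rewrite -E u_r p_root.
  by exists (p u); rewrite ?innerP // !inE E !eqxx u_r orbT.
- have v_r : v != r by apply: contra_neq uv_neq => v_r; rewrite -E v_r p_root.
  by exists (p v); rewrite ?innerP // !inE E !eqxx v_r orbT.
- have [u_r|u_r] := eqVneq u r.
    have v_r : v != r by rewrite -u_r eq_sym.
    by exists (p v); rewrite ?innerP // !inE eqxx v_r orbT -E u_r p_root eqxx.
  exists (p u); rewrite ?innerP // !inE E eqxx u_r orbT /=.
  by have [->|] := eqVneq v r; rewrite /= ?p_root ?eqxx ?orbT.
Qed.

Lemma card_neighbours_block (J : {set G}) u : u \in J ->
  (#|[set v in J | adj u v]| <=
   \sum_(c in inner | u \in block c) #|J :&: block c|.-1)%N.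
Proof.
move=> uJ; apply: (@leq_trans
  #|\bigcup_(c in inner | u \in block c) ((J :&: block c) :\ u)|).
  apply/subset_leq_card/subsetP => v; rewrite inE => /andP[vJ uv].
  have [c c_in /andP[uc vc]] := adj_block uv.
  apply/bigcupP; exists c; rewrite ?c_in // in_setD1 in_setI vJ vc !andbT.
  by apply: contraTneq uv => ->; rewrite adj_irrefl.
elim/big_rec2: _ => [|c k A /andP[_ uc] leA]; first by rewrite cards0.
rewrite (leq_trans (leq_card_setU _ _)) // leq_add //.
by rewrite (cardsD1 u (J :&: block c)) in_setI uJ uc.
Qed.

(** Every adjacent pair lies in a common block, and inside a block [u] is not its own neighbour;
    this is where [I \subset J] enters. *)
Lemma edge_count_block (I J : {set G}) : I \subset J ->
  (edge_count I J <= \sum_(c in inner) #|I :&: block c| * #|J :&: block c|.-1)%N.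
Proof.
move=> /subsetP sIJ.
apply: (@leq_trans (\sum_(u in I)
    \sum_(c in inner | u \in block c) #|J :&: block c|.-1)).
  by apply: leq_sum => u uI; exact/card_neighbours_block/sIJ.
rewrite (exchange_big_dep (mem inner)) /=; last by move=> u c _ /andP[].
apply: leq_sum => c c_in; rewrite sum_nat_const leq_mul2r.
apply/orP; right; apply/subset_leq_card/subsetP => u.
by rewrite unfold_in in_setI => /and3P[-> _ ->].
Qed.

(** The size of the block minus 2, that is, its excess over a single edge. *)
Let t c := #|children c|.-1.

Lemma sum_excess : (\sum_(c in inner) t c <= m - 2)%N.
Proof.
have E : (\sum_(c in inner) #|children c| = #|G|.-1)%N.
  have := sum_children setT; rewrite setTD cardsC1 => <-.
  by apply: eq_bigr => c _; rewrite setTI.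
have : (\sum_(c in inner) t c + #|inner| = #|G|.-1)%N.
  rewrite -E -sum1_card -big_split /=; apply: eq_bigr => c /children_gt0.
  by rewrite /t; lia.
move: inner_card; lia.
Qed.

Lemma excess_le c : c \in inner -> (t c <= m - 2)%N.
Proof.
by move=> c_in; apply: leq_trans sum_excess; rewrite (bigD1 c) //= leq_addr.
Qed.

Lemma card_setI_block_le (J : {set G}) c : c \in inner ->
  (#|J :&: block c| <= (t c).+2)%N.
Proof.
move=> /children_gt0 c_gt0; rewrite (leq_trans (subset_leq_card (subsetIr _ _))) //.
by rewrite card_block /t; lia.
Qed.

Lemma edge_count_le_complete (I J : {set G}) : I \subset J ->
  (edge_count I J <= #|I| * #|J|.-1)%N.
Proof.
move=> /subsetP sIJ; rewrite -sum_nat_const leq_sum // => u uI.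
rewrite (cardsD1 u J) sIJ //= subset_leq_card //.
apply/subsetP => v; rewrite !inE => /andP[-> uv]; rewrite andbT.
by apply: contraTneq uv => ->; rewrite adj_irrefl.
Qed.

Hypothesis m_gt1 : (1 < m)%N.

(** Every degree is at most [m]: a block gives a vertex at most its excess plus one neighbours,
    there are at most two blocks at a vertex, and all excesses sum to at most [m - 2]. *)
Lemma edge_count_le_degree (I J : {set G}) : I \subset J ->
  (edge_count I J <= #|I| * m)%N.
Proof.
move=> /subsetP sIJ; rewrite -sum_nat_const leq_sum // => u uI.
rewrite (leq_trans (card_neighbours_block (sIJ u uI))) //.
apply: (@leq_trans (\sum_(c in inner | u \in block c) (t c + 1))).
  apply: leq_sum => c /andP[c_in _].
  by have := card_setI_block_le J c_in; lia.
rewrite big_split /= -(subnK m_gt1) leq_add //.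
  apply: leq_trans sum_excess; rewrite [X in (_ <= X)%N](bigID (fun c => u \in block c)).
  exact: leq_addr.
have := sum_block [set u]; rewrite cards1 muln1; apply: leq_trans.
rewrite big_mkcondr leq_sum // => c _; case: ifP => // uc.
by rewrite card_gt0; apply/set0Pn; exists u; rewrite in_setI inE eqxx.
Qed.

(** Let [i] and [j] be the intersection sizes with one block. For [i > 0], [i * (j - 1) = (j - 1) +
    (i - 1) * (j - 1)] with [j - 1 <= m - 1], and [sum_block_pred] bounds both sums. *)
Lemma edge_count_le_inner (I J : {set G}) : I \subset J -> I != set0 ->
  (edge_count I J <= #|J|.-1 + #|I|.-1 * m.-1)%N.
Proof.
move=> sIJ I_neq0; have J_neq0 : J != set0.
  by apply: contraNneq I_neq0 => J0; move: sIJ; rewrite J0 subset0.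
apply: (leq_trans (edge_count_block sIJ)).
apply: (@leq_trans (\sum_(c in inner)
    (#|J :&: block c|.-1 + #|I :&: block c|.-1 * m.-1))).
  apply: leq_sum => c c_in.
  have := card_setI_block_le J c_in; have := excess_le c_in.
  move: m_gt1 #|J :&: _| #|I :&: _| (t c) => ? j i tc ? ?; nia.
rewrite big_split /= -big_distrl /= leq_add ?leq_mul ?sum_block_pred //.
Qed.

(** Blockwise, [i * (j - 1) <= i + i * t], and [i * t <= t * m] because [i <= t + 2 <= m]. *)
Lemma edge_count_le_twice (I J : {set G}) : I \subset J ->
  (edge_count I J <= 2 * #|I| + (m - 2) * m)%N.
Proof.
move=> sIJ; apply: (leq_trans (edge_count_block sIJ)).
apply: (@leq_trans (\sum_(c in inner) (#|I :&: block c| + t c * m))).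
  apply: leq_sum => c c_in.
  have := card_setI_block_le J c_in; have := excess_le c_in.
  have := card_setI_block_le I c_in.
  move: m_gt1 #|J :&: _| #|I :&: _| (t c) => ? j i tc ? ?; nia.
by rewrite big_split /= -big_distrl leq_add ?sum_block // leq_mul2r sum_excess orbT.
Qed.

(** Blockwise, for [1 <= i <= j], the product [i * (j - 1)] equals
    [(i - 1) + (j - 1) + (i - 1) * (j - 2)], whose last term is at most
    [(t + 1) * t <= (m - 1) * t]. *)
Lemma edge_count_le_sum (I J : {set G}) : I \subset J -> I != set0 ->
  (edge_count I J <= #|I|.-1 + #|J|.-1 + (m - 2) * m.-1)%N.
Proof.
move=> sIJ I_neq0; have J_neq0 : J != set0.
  by apply: contraNneq I_neq0 => J0; move: sIJ; rewrite J0 subset0.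
apply: (leq_trans (edge_count_block sIJ)).
apply: (@leq_trans (\sum_(c in inner)
    (#|I :&: block c|.-1 + #|J :&: block c|.-1 + t c * m.-1))).
  apply: leq_sum => c c_in.
  have := card_setI_block_le J c_in; have := excess_le c_in.
  have : (#|I :&: block c| <= #|J :&: block c|)%N by rewrite subset_leq_card // setSI.
  move: m_gt1 #|J :&: _| #|I :&: _| (t c) => ? [|j] [|i] tc //=; try lia.
  nia.
rewrite !big_split /= -big_distrl !leq_add ?sum_block_pred //.
by rewrite leq_mul2r sum_excess orbT.
Qed.

(** Each range of sizes [i], [j] has one of the five bounds equal to [star_count]: the complete
    bound for [j <= m]; for [i <= m < j] the degree bound if [i <= j - m] and the inner bound
    otherwise; for [m < i] the twice bound if [i <= j - m] and the sum bound otherwise. *)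
Lemma edge_count_le_star (I J : {set G}) : I \subset J ->
  (edge_count I J <= star_count m #|I| #|J|)%N.
Proof.
move=> sIJ; have [->|I_neq0] := eqVneq I set0.
  by rewrite /edge_count big_set0.
have I_gt0 : (0 < #|I|)%N by rewrite card_gt0.
have leIJ := subset_leq_card sIJ.
have := edge_count_le_complete sIJ; have := edge_count_le_degree sIJ.
have := edge_count_le_inner sIJ I_neq0; have := edge_count_le_twice sIJ.
have := edge_count_le_sum sIJ I_neq0.
rewrite /star_count; move: m_gt1 I_gt0 leIJ.
move: (edge_count I J) #|I| #|J| => e i j m_gt1' i_gt0 le_ij leE leD leC leB leA.
have [le_jm|lt_mj] := leqP j m.
  by rewrite (minn_idPl (leq_trans le_ij le_jm)); lia.
have [le_im|lt_mi] := leqP i m.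
  clear leE leD leA; case: i i_gt0 le_im le_ij leB leC => // i _.
  case: m m_gt1' lt_mj => [|[|k]] // _ lt_mj le_im le_ij leB leC /=.
  by move: leB leC; rewrite /= mulnS => leB leC; have [|] := leqP i.+1 (j - k.+2); lia.
clear leC leB leA le_ij; case: m m_gt1' lt_mj lt_mi leE leD => [|[|k]] // _.
by rewrite subn2 /= => lt_mj lt_mi leE leD; have [|] := leqP i (j - k.+2); lia.
Qed.

End BlockBound.

(** * Dominator trees *)

Lemma connect_exit (T : finType) (e : rel T) (S : pred T) x y :
  connect e x y -> S x -> ~~ S y -> exists u z, [/\ S u, ~~ S z & e u z].
Proof.
move=> /connectP[q]; elim: q x => [|z q IHq] x /=; first by move=> _ -> ->.
case/andP=> xz q_path y_last Sx Sy; have [Sz|Sz] := boolP (S z); first exact: (IHq z).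
by exists x, z.
Qed.

Section Dominators.
Variables (G : sgraph) (r : G).
Hypothesis G_conn : connected_graph G.

Definition avoiding (c : G) : rel G := fun x y => [&& adj x y, x != c & y != c].

(** The vertices that [c] separates from the root. For [c = r] these are all vertices other than
    [r], so the root dominates every other vertex. *)
Definition dominated c : {set G} := [set v | (v != c) && ~~ connect (avoiding c) r v].

Definition dominators v : {set G} := [set c | v \in dominated c].

(** The dominator nearest to [v] is the one with the fewest dominated vertices. The default [r] of
    the minimum is itself a dominator when [v != r]. *)
Definition idom v := if v == r then r
  else [arg min_(c < r in dominators v) #|dominated c|].

Lemma connected_connect (x y : G) : connect (@adj G) x y.
Proof.
case/andP: G_conn => _ /existsPn/(_ x)/existsPn/(_ y); exact: negbNE.
Qed.

Lemma root_notin_dominated c : r \notin dominated c.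
Proof. by rewrite inE negb_and negbK connect0 orbT. Qed.

Lemma dominated_root v : (v \in dominated r) = (v != r).
Proof.
rewrite inE; have [//|v_r] := eqVneq v r; apply/negP => /connectP[[|z q] /=].
  by move=> _ v_eq; rewrite v_eq eqxx in v_r.
by rewrite /avoiding eqxx andbF.
Qed.

Lemma dominated_adj c (u v : G) : adj u v -> u != c -> v != c ->
  (u \in dominated c) = (v \in dominated c).
Proof.
move=> uv u_c v_c; rewrite !inE u_c v_c /=; congr (~~ _).
by apply/idP/idP => r_w; apply: connect_trans r_w (connect1 _);
  rewrite /avoiding ?u_c ?v_c ?andbT // adj_sym.
Qed.

(** A walk from the root avoiding [c] never meets [v], so whatever is reached without [c] is also
    reached without [v]; the same holds for [c] itself. *)
Lemma dominated_sub c v : v \in dominated c -> dominated v \subset dominated c.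
Proof.
move=> v_c; apply/subsetP => w w_v.
have w_r : w != r by apply: contraTneq w_v => ->; rewrite root_notin_dominated.
have [->|c_r] := eqVneq c r; first by rewrite dominated_root.
have not_v u : connect (avoiding c) r u -> u != v.
  by apply: contraTneq => ->; move: v_c; rewrite inE => /andP[].
have sub_path q x : connect (avoiding c) r x -> path (avoiding c) x q ->
    connect (avoiding v) x (last x q).
  elim: q x => [|z q IHq] x r_x /=; first by rewrite connect0.
  move=> /andP[xz q_path]; have r_z := connect_trans r_x (connect1 xz).
  apply: connect_trans (IHq _ r_z q_path); apply: connect1.
  by rewrite /avoiding (not_v _ r_x) (not_v _ r_z); case/and3P: xz => ->.
have sub_cv u : connect (avoiding c) r u -> connect (avoiding v) r u.
  by case/connectP=> q q_path ->; apply: sub_path q_path; exact: connect0.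
(* A walk from [r] to [v] leaves the region reachable without [c], and it can do so only at [c];
   hence [c] is reached without passing through [v]. *)
have [||u [z [/andP[u_c r_u] Sz uz]]] := @connect_exit _ _
    (fun u => (u != c) && connect (avoiding c) r u) _ _ (connected_connect r v).
- by rewrite eq_sym c_r connect0.
- by move: v_c; rewrite inE => /andP[-> ->].
have z_c : z = c.
  apply/eqP; apply: contraR Sz => z_c; rewrite z_c /=.
  by apply: connect_trans r_u (connect1 _); rewrite /avoiding uz u_c.
have r_c : connect (avoiding v) r c.
  apply: connect_trans (sub_cv _ r_u) (connect1 _).
  rewrite /avoiding not_v //= -z_c uz /= z_c.
  by move: v_c; rewrite inE eq_sym => /andP[].
move: w_v; rewrite !inE => /andP[_ w_v]; apply/andP; split.
  by apply: contraNneq w_v => ->.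
by apply: contra w_v; exact: sub_cv.
Qed.

Lemma idomP v : v != r -> v \in dominated (idom v) /\
  forall c, v \in dominated c -> #|dominated (idom v)| <= #|dominated c|.
Proof.
move=> v_r; rewrite /idom (negPf v_r); case: arg_minnP => [|c]; rewrite inE.
  by rewrite dominated_root.
by move=> v_c min_c; split=> // c' v_c'; apply: min_c; rewrite inE.
Qed.

Lemma dominated_lt c v : v \in dominated c -> #|dominated v| < #|dominated c|.
Proof.
move=> v_c; apply: proper_card; rewrite properE dominated_sub //=.
by apply/subsetPn; exists v => //; rewrite inE eqxx.
Qed.

(** A member of [J] that dominates the most vertices works, since its immediate dominator dominates
    strictly more. *)
Lemma idom_rooted (J : {set G}) : J != set0 -> r \notin J ->
  exists2 v, v \in J & idom v \notin J.
Proof.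
case/set0Pn=> v0 v0J rJ.
case: (@arg_maxnP _ v0 (mem J) (fun v => #|dominated v|)) => // v vJ max_v.
exists v => //; apply/negP => /max_v /=; apply/negP; rewrite -ltnNge dominated_lt //.
by apply: (proj1 (idomP _)); apply: contraNneq rJ => <-.
Qed.

(** If [idom u] were not [v], it would also dominate the neighbour [v] of [u], and then [v] would be
    a dominator of [u] with a strictly smaller dominated set. *)
Lemma idom_adj_dominated (u v : G) : adj u v -> u \in dominated v -> idom u = v.
Proof.
move=> uv u_v; have u_r : u != r.
  by apply: contraTneq u_v => ->; rewrite root_notin_dominated.
have [u_idom min_idom] := idomP u_r.
apply/eqP; apply: contraTT (min_idom _ u_v) => idom_v.
rewrite -ltnNge dominated_lt // -(dominated_adj uv) //; last by rewrite eq_sym.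
by move: u_idom; rewrite inE => /andP[].
Qed.

(** If neither end dominates the other, any third vertex dominates both or none, so both ends have
    the same dominators. *)
Lemma idom_adj (u v : G) : adj u v ->
  [|| idom u == v, idom v == u | idom u == idom v].
Proof.
move=> uv; have [u_v|u_v] := boolP (u \in dominated v).
  by rewrite (idom_adj_dominated uv u_v) eqxx.
have [v_u|v_u] := boolP (v \in dominated u).
  by rewrite (idom_adj_dominated _ v_u) ?eqxx ?orbT // adj_sym.
have dom_eq : dominators u = dominators v.
  have self w : w \in dominated w = false by rewrite inE eqxx.
  apply/setP=> c; rewrite [LHS]in_set [RHS]in_set.
  have [<-|u_c] := eqVneq u c; first by rewrite self (negPf v_u).
  have [<-|v_c] := eqVneq v c; first by rewrite self (negPf u_v).
  exact: dominated_adj.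
rewrite {3 4}/idom -dom_eq.
have [u_r|u_r] := eqVneq u r.
  rewrite /idom; have [|v_r] := eqVneq v r; first by move=> ->; rewrite eqxx !orbT.
  by move: v_u; rewrite u_r dominated_root v_r.
have [v_r|v_r] := eqVneq v r; last by rewrite eqxx !orbT.
by move: u_v; rewrite v_r dominated_root u_r.
Qed.

Lemma connect_avoiding c (x y : {v : G | v != c}) :
  connect (avoiding c) (val x) (val y) -> connect (@del_adj G c) x y.
Proof.
case/connectP=> q; elim: q x => [|z q IHq] x /=.
  by move=> _ /val_inj->; exact: connect0.
case/andP=> /and3P[xz _ z_c] q_path y_last.
apply: (connect_trans (y := exist _ z z_c)); first exact: connect1.
exact: IHq.
Qed.

(** Deleting [c] cuts some vertex off from the root, so [c] dominates something. A walk from the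
    root enters the dominated set from [c], and the vertex entered is a child of [c]. *)
Lemma cut_vertex_dominated c : c != r -> c \in cut_vertices G ->
  exists2 v, v != r & idom v = c.
Proof.
move=> c_r; rewrite inE => /existsP[x /existsP[y xy]].
have [v v_c] : exists v, v \in dominated c.
  apply/set0Pn; apply: contraNneq xy => dom0.
  have r_c : r != c by rewrite eq_sym.
  have r_w (w : {v : G | v != c}) : connect (@del_adj G c) (exist _ r r_c) w.
    apply: connect_avoiding => /=.
    have /setP/(_ (val w)) := dom0; rewrite !in_set (valP w) /=.
    by move/negbFE.
  apply: connect_trans (r_w y).
  by rewrite (sym_connect_sym (@del_adj_sym G c)).
have [||u [z [u_c]]] := @connect_exit _ _
    (fun u => u \notin dominated c) _ _ (connected_connect r v).
- exact: root_notin_dominated.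
- by rewrite v_c.
rewrite negbK => z_c uz.
have u_eq : u = c.
  apply/eqP; apply: contraR u_c => u_c; rewrite (dominated_adj uz) //.
  by move: z_c; rewrite inE => /andP[].
exists z; first by apply: contraTneq z_c => ->; rewrite root_notin_dominated.
by apply: idom_adj_dominated => //; rewrite -u_eq adj_sym.
Qed.

Lemma root_in_inner : 1 < #|G| -> r \in inner r idom.
Proof.
move=> G_gt1; have [||v v_r] := @idom_rooted [set~ r].
- by apply/set0Pn/card_gt0P; rewrite cardsC1; lia.
- by rewrite !inE eqxx.
by rewrite !inE negbK => /eqP v_eq; rewrite -[X in X \in _]v_eq; apply: imset_f.
Qed.

End Dominators.

(** Any rooting [r0] will do: a leaf of its dominator tree exists, as there are fewer parents than
    vertices, and neither [r0] nor a cut vertex is a leaf. *)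
Lemma exists_noncut (G : sgraph) : connected_graph G -> 1 < #|G| ->
  exists r : G, r \notin cut_vertices G.
Proof.
move=> G_conn G_gt1; have /card_gt0P[r0 _] : 0 < #|G| by lia.
have [v v_in] : exists v, v \notin inner r0 (idom r0).
  apply/existsP; rewrite -negb_forall; apply/negP => /forallP all_in.
  have : #|G| <= #|inner r0 (idom r0)|.
    by rewrite -cardsT subset_leq_card //; apply/subsetP => v _; exact: all_in.
  have : #|inner r0 (idom r0)| <= #|G|.-1 by rewrite -(cardsC1 r0) leq_imset_card.
  by move: G_gt1; lia.
exists v; apply/negP => v_cut; have [|w w_r0 w_v] := cut_vertex_dominated G_conn (r := r0) _ v_cut.
  by apply: contraNneq v_in => ->; apply: root_in_inner.
by case/negP: v_in; rewrite -w_v; apply: imset_f; rewrite !inE.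
Qed.

(** The strict inequality comes from rooting at a vertex that is not a cut vertex: the root is then
    one more inner vertex besides the cut vertices. *)
Lemma exists_parent_map (G : sgraph) : connected_graph G -> 1 < #|G| ->
  exists (r : G) (p : G -> G), [/\ p r = r,
    forall J : {set G}, J != set0 -> r \notin J -> exists2 v, v \in J & p v \notin J,
    forall u v : G, adj u v -> [|| p u == v, p v == u | p u == p v] &
    #|cut_vertices G| < #|inner r p|].
Proof.
move=> G_conn G_gt1; have [r r_cut] := exists_noncut G_conn G_gt1.
exists r, (idom r); split.
- by rewrite /idom eqxx.
- exact: idom_rooted.
- exact: idom_adj.
rewrite (_ : _.+1 = #|r |: cut_vertices G|); last by rewrite cardsU1 r_cut.
apply/subset_leq_card/subsetP => c; rewrite in_setU1.
case/predU1P=> [->|c_cut]; first exact: root_in_inner.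
have [|v v_r <-] := cut_vertex_dominated G_conn (r := r) _ c_cut.
  by apply: contraNneq r_cut => <-.
by apply: imset_f; rewrite !inE.
Qed.

(** * The extremal graph *)

Section CliqueChains.
Variables m n : nat.

Definition clique_chains_adj : rel 'I_n := fun a b =>
  (a != b) && [|| (a < m) && (b < m), a == b + m :> nat | b == a + m :> nat]%N.

Lemma clique_chains_sym : symmetric clique_chains_adj.
Proof. by move=> a b; rewrite /clique_chains_adj eq_sym andbC orbCA; lia. Qed.

Lemma clique_chains_irrefl : irreflexive clique_chains_adj.
Proof. by move=> a; rewrite /clique_chains_adj eqxx. Qed.

Definition clique_chains : sgraph := SGraph clique_chains_sym clique_chains_irrefl.

Definition initial (s : nat) : {set 'I_n} := [set i : 'I_n | (i < s)%N].

Lemma sum_initial (F : nat -> nat) s : (s <= n)%N ->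
  (\sum_(i in initial s) F i = \sum_(0 <= i < s) F i)%N.
Proof.
move=> le_sn; rewrite big_mkord (big_ord_widen_cond n xpredT F le_sn).
by apply: eq_bigl => i; rewrite inE.
Qed.

Lemma card_initial s : (s <= n)%N -> #|initial s| = s.
Proof.
move=> le_sn; rewrite -sum1_card (sum_initial (fun=> 1%N) le_sn).
by rewrite sum_nat_const_nat subn0 muln1.
Qed.

Lemma initial_sub s t : (s <= t)%N -> initial s \subset initial t.
Proof. by move=> le_st; apply/subsetP => i; rewrite !inE => /leq_trans; apply. Qed.

Lemma edge_count_clique_chains i j : (0 < m)%N -> (i <= j <= n)%N ->
  @edge_count clique_chains (initial i) (initial j) = star_count m i j.
Proof.
move=> m_gt0 /andP[le_ij le_jn]; have le_in := leq_trans le_ij le_jn.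
pose f a b : nat := (a != b) && [|| (a < m) && (b < m), a == b + m | b == a + m]%N.
(* The neighbours of [a] split into clique neighbours, [a + m] and [a - m]; the factor [m <= a]
   guards the truncated subtraction. *)
have fE a b : f a b = ((a < m) * ((b < m) && (b != a)) + (b == a + m) +
    (m <= a) * (b == a - m))%N.
  by rewrite /f; case: (ltnP a m); case: (ltnP b m) => /=; lia.
have sum_eq c k : (\sum_(0 <= b < k) (b == c) = (c < k))%N.
  by elim: k => [|k IHk]; [rewrite big_geq | rewrite big_nat_recr //= IHk; lia].
have sum_clique a k : (\sum_(0 <= b < k) ((b < m) && (b != a))
    = minn k m - ((a < m) && (a < k)))%N.
  by elim: k => [|k IHk]; [rewrite big_geq ?min0n | rewrite big_nat_recr //= IHk; lia].
have sum_lt k c : (\sum_(0 <= a < k) (a < c) = minn k c)%N.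
  by elim: k => [|k IHk]; [rewrite big_geq ?min0n | rewrite big_nat_recr //= IHk; lia].
have sum_ge k : (\sum_(0 <= a < k) (m <= a) = k - m)%N.
  by elim: k => [|k IHk]; [rewrite big_geq | rewrite big_nat_recr //= IHk; lia].
rewrite /edge_count /star_count.
transitivity (\sum_(a in initial i) \sum_(0 <= b < j) f a b)%N.
  apply: eq_bigr => a _; rewrite -(sum_initial _ le_jn) -sum1_card.
  rewrite [RHS]big_mkcond [LHS]big_mkcond; apply: eq_bigr => b _.
  by rewrite !inE /=; case: ltnP; rewrite //= /f /clique_chains_adj; case: ifP.
rewrite (sum_initial (fun a => \sum_(0 <= b < j) f a b)%N le_in).
transitivity (\sum_(0 <= a < i) ((a < m) * (minn j m).-1 + (a < j - m) + (m <= a)))%N.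
  apply: eq_big_nat => a /andP[_ lt_ai].
  under eq_bigr do rewrite fE.
  rewrite !big_split /= -!big_distrr /= !sum_eq sum_clique.
  by case: (ltnP a m); lia.
by rewrite !big_split /= -big_distrl /= !sum_lt sum_ge.
Qed.

End CliqueChains.

(** * Isomorphisms and balanced path lengths *)

Definition star_bounded (m : nat) (G : sgraph) : Prop :=
  forall I J : {set G}, I \subset J -> (edge_count I J <= star_count m #|I| #|J|)%N.

Lemma star_bounded_iso m (G H : sgraph) : isomorphic G H ->
  star_bounded m H -> star_bounded m G.
Proof.
move=> [f [f_bij fadj]] Hm I J sIJ; have f_inj := bij_inj f_bij.
have := Hm (f @: I) (f @: J) (imsetS f sIJ).
rewrite !card_imset //; congr (_ <= _)%N.
rewrite /edge_count big_imset /=; last by move=> ? ? _ _; apply: f_inj.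
apply: eq_bigr => u _; rewrite -(card_imset _ f_inj); apply: eq_card => v.
case: f_bij => g fK gK; rewrite -[v]gK (mem_imset _ _ f_inj) !inE.
by rewrite (mem_imset _ _ f_inj) fadj.
Qed.

Lemma isomorphic_sym (G H : sgraph) : isomorphic G H -> isomorphic H G.
Proof.
move=> [f [[g fK gK] fadj]]; exists g; split; first by exists f.
by move=> x y; rewrite -fadj !gK.
Qed.

Lemma isomorphic_trans (G H K : sgraph) :
  isomorphic G H -> isomorphic H K -> isomorphic G K.
Proof.
move=> [f [f_bij fadj]] [g [g_bij gadj]]; exists (g \o f); split.
  exact: bij_comp.
by move=> x y; rewrite /= gadj fadj.
Qed.

(** A criterion by coordinates: [base] names the path and [h] the height on it. Injectivity and
    equal cardinalities make the coordinate map bijective. *)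
Lemma isomorphic_paths_on_clique (m : nat) (l : 'I_m -> nat) (H : sgraph)
    (base : H -> 'I_m) (h : H -> nat) :
  (forall v, h v <= l (base v)) ->
  (forall u v, base u = base v -> h u = h v -> u = v) ->
  #|H| = \sum_i (l i).+1 ->
  (forall u v, adj u v = if base u == base v then (h u == (h v).+1) || (h v == (h u).+1)
    else (h u == 0) && (h v == 0)) ->
  isomorphic H (paths_on_clique l).
Proof.
move=> le_h bh_inj H_card H_adj.
pose f (v : H) : paths_on_clique l :=
  Tagged (fun i => 'I_(l i).+1) (inord (h v) : 'I_(l (base v)).+1).
have f_h v : tagged (f v) = h v :> nat by rewrite /= inordK // ltnS.
have f_inj : injective f.
  move=> u v fuv; apply: bh_inj; first exact: (congr1 tag fuv).
  by rewrite -!f_h fuv.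
exists f; split.
  apply: inj_card_bij => //; rewrite card_tagged H_card sumnE big_map big_enum /=.
  by apply: leq_sum => i _; rewrite card_ord.
by move=> u v; rewrite H_adj /= /pc_adj !f_h.
Qed.

(** A length below the floor of the average forces all lengths to be at most this floor, making the
    sum too small; a length above the floor plus one makes it too large. *)
Lemma balanced_nearly_const (k m : nat) (l : 'I_m -> nat) : balanced k l ->
  forall i, k %/ m <= l i <= (k %/ m).+1.
Proof.
move=> [sum_l diff_l] i.
have m_gt0 : 0 < m by apply: leq_ltn_trans (ltn_ord i).
have diff j : l i <= (l j).+1 /\ l j <= (l i).+1 by have := diff_l i j; lia.
apply/andP; split.
  rewrite leqNgt; apply/negP => lt_l.
  have : k < k %/ m * m.
    rewrite -{1}sum_l -[X in _ * X]card_ord mulnC -sum_nat_const.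
    rewrite (bigD1 i) //= [X in _ < X](bigD1 i) //= -addSn leq_add // leq_sum // => j _.
    by have := diff j; lia.
  by rewrite ltnNge leq_divM.
rewrite leqNgt; apply/negP => lt_l.
have : (k %/ m).+1 * m <= k.
  rewrite -{2}sum_l -[X in _ * X]card_ord mulnC -sum_nat_const leq_sum // => j _.
  by have := diff j; lia.
by rewrite leqNgt -ltn_divLR // ltnSn.
Qed.

(** Both families take the value [q + 1] exactly [k - m * q] times and the value [q] otherwise, so
    they agree as multisets. *)
Lemma balanced_perm (k m : nat) (l l' : 'I_m -> nat) :
  balanced k l -> balanced k l' -> exists s : {perm 'I_m}, forall i, l' i = l (s i).
Proof.
move=> bl bl'; pose q := k %/ m.
(* The number of values satisfying [a], with the term [a q * (k - m * q)] moved to the left to avoid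
   a subtraction. *)
have two_values (f : 'I_m -> nat) (a : pred nat) : balanced k f ->
    count a [tuple f i | i < m] + a q * (k - m * q) = a q.+1 * (k - m * q) + a q * m.
  move=> bf; have f_q := balanced_nearly_const bf.
  have E : \sum_i (f i == q.+1) = k - m * q.
    case: bf => sum_f _; rewrite -{1}sum_f.
    rewrite [in RHS](eq_bigr (fun i => (f i == q.+1) + q)); last first.
      by move=> i _; have := f_q i; rewrite -/q; lia.
    by rewrite big_split /= sum_nat_const card_ord addnK.
  rewrite -{}E -sum1_count big_map big_enum_cond /= big_mkcond /=.
  rewrite !big_distrr /= -[X in _ = _ + _ * X]card_ord mulnC -sum_nat_const -!big_split /=.
  apply: eq_bigr => i _; have := f_q i; rewrite -/q => f_qi.
  have [->|->] : f i = q \/ f i = q.+1 by lia.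
    by rewrite (ltn_eqF (ltnSn q)); case: (a q); case: (a q.+1).
  by rewrite eqxx; case: (a q); case: (a q.+1).
have /tuple_permP[s E] : perm_eq [tuple l' i | i < m] [tuple l i | i < m].
  apply/seq.permP => a; apply: (@addIn (a q * (k - m * q))); rewrite !two_values //.
exists s => i; have : tnth [tuple l' i | i < m] i = nth 0 [tuple l' i | i < m] i by exact: tnth_nth.
rewrite E (nth_map i) ?size_enum_ord // nth_ord_enum !tnth_map !tnth_ord_tuple.
by [].
Qed.

(** * Graphs in layers of size [m] over a bottom clique *)

Section Layered.
Variables (m n : nat) (e : rel 'I_n) (e_sym : symmetric e) (e_irrefl : irreflexive e).
Variable par : 'I_n -> 'I_n.
Local Notation H := (SGraph e_sym e_irrefl).

Hypotheses (m_gt0 : 0 < m) (le_mn : m <= n).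
Hypothesis bottom_clique : forall u v : 'I_n, u < m -> v < m -> u != v -> e u v.
Hypothesis layer_stable : forall u v : 'I_n, e u v -> u %/ m = v %/ m -> u < m.
Hypothesis parE : forall u v : 'I_n, u %/ m < v %/ m -> e u v = (u == par v).
Hypothesis par_layer : forall v : 'I_n, m <= v -> (par v %/ m).+1 = v %/ m.
Hypothesis par_inj : forall u v : 'I_n, m <= u -> u %/ m = v %/ m ->
  par u = par v -> u = v.

Let h (v : 'I_n) := v %/ m.

Let h_gt0 v : (0 < h v) = (m <= v). Proof. by rewrite divn_gt0. Qed.

Let iter_par_layer j v : j <= h v -> h (iter j par v) = h v - j.
Proof.
elim: j => [|j IHj] le_j; first by rewrite subn0.
have := IHj (ltnW le_j); rewrite iterS => h_j.
have := @par_layer (iter j par v); rewrite -h_gt0 -!/(h _) h_j subn_gt0 => /(_ le_j).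
lia.
Qed.

Let iter_par_inj j u v : h u = j -> h v = j -> iter j par u = iter j par v -> u = v.
Proof.
elim: j u v => [|j IHj] u v // hu hv; rewrite !iterSr => /IHj E.
have mu : m <= u by rewrite -h_gt0 hu.
have mv : m <= v by rewrite -h_gt0 hv.
apply: par_inj => //; first by rewrite -!/(h _) hu.
by apply: E; [have := par_layer mu | have := par_layer mv]; rewrite -!/(h _); lia.
Qed.

Let base_lt v : iter (h v) par v < m.
Proof. by rewrite ltnNge -h_gt0 iter_par_layer // subnn. Qed.

Let base v : 'I_m := Ordinal (base_lt v).

Let base_inj u v : base u = base v -> h u = h v -> u = v.
Proof.
move=> /(congr1 val) /= b_eq h_eq; apply: (@iter_par_inj (h v)) => //.
by apply: val_inj; rewrite /= -b_eq h_eq.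
Qed.

Let base_iter j v : j <= h v -> base (iter j par v) = base v.
Proof.
move=> le_j; apply: val_inj; rewrite /= iter_par_layer // -iterD subnK //.
Qed.

(** The [m] vertices [j * m + r] of a full layer have distinct bases, and an injective map of ['I_m]
    into itself is onto. *)
Let base_surj j i : j < n %/ m -> exists v, h v = j /\ base v = i.
Proof.
move=> lt_j; have lt_n (r : 'I_m) : j * m + r < n.
  have : j.+1 * m <= n by rewrite -leq_divRL.
  by rewrite mulSn; have := ltn_ord r; lia.
have h_r r : h (Ordinal (lt_n r)) = j.
  by rewrite /h /= divnMDl // divn_small // addn0.
pose f r := base (Ordinal (lt_n r)).
have f_inj : injective f.
  move=> r r' /base_inj; rewrite !h_r => /(_ erefl) [] /addnI.
  exact: val_inj.
have [g _ gK] := injF_bij f_inj.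
by exists (Ordinal (lt_n (g i))); rewrite h_r -/(f _) gK.
Qed.

Let column i : {set 'I_n} := [set v | base v == i].

(** A column meets every full layer, by [base_surj], and no layer twice, by [base_inj]. *)
Let card_column_bounds i : n %/ m <= #|column i| <= (n %/ m).+1.
Proof.
pose f v : 'I_(n %/ m).+1 := inord (h v).
have fE v : f v = h v :> nat.
  by rewrite inordK // ltnS leq_div2r // ltnW.
apply/andP; split; last first.
  rewrite -[X in _ <= X]card_ord -(@card_in_imset _ _ f) ?max_card //.
  move=> u v; rewrite !inE => /eqP bu /eqP bv /(congr1 val) /=; rewrite !fE.
  by apply: base_inj; rewrite bu.
apply: leq_trans (leq_imset_card f _).
rewrite -{1}(@card_initial (n %/ m).+1 (n %/ m)) //.
apply/subset_leq_card/subsetP => j; rewrite inE => /(base_surj i)[v [h_v b_v]].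
apply/imsetP; exists v; first by rewrite inE b_v.
by apply: ord_inj; rewrite fE h_v.
Qed.

Let column_gt0 i : 0 < #|column i|.
Proof.
by have /andP[le_c _] := card_column_bounds i; rewrite (leq_trans _ le_c) // divn_gt0.
Qed.

Let column_balanced : balanced (n - m) (fun i => #|column i|.-1).
Proof.
split.
  have : \sum_i #|column i| = n.
    rewrite -[RHS]card_ord -sum1_card (partition_big base xpredT) //=.
    by apply: eq_bigr => i _; rewrite -sum1_card; apply: eq_bigl => v; rewrite inE.
  rewrite (eq_bigr (fun i => #|column i|.-1 + 1)); last first.
    by move=> i _; rewrite addn1 prednK.
  by rewrite big_split /= sum1_card card_ord; lia.
move=> i j; have := card_column_bounds i; have := card_column_bounds j.
have := column_gt0 i; have := column_gt0 j; lia.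
Qed.

Let h_le_column v : h v <= #|column (base v)|.-1.
Proof.
rewrite -ltnS prednK //; pose f (j : 'I_(h v).+1) := iter j par v.
have f_inj : injective f.
  move=> i j /(congr1 h); rewrite /f !iter_par_layer -1?ltnS // => E.
  by apply: val_inj; have := ltn_ord i; have := ltn_ord j; rewrite /= !ltnS; lia.
rewrite -[X in X <= _]card_ord -cardsT -(card_imset _ f_inj).
apply/subset_leq_card/subsetP => _ /imsetP[j _ ->].
by rewrite inE base_iter // -ltnS.
Qed.

(** The columns are the pendent paths with their clique vertices. Their lengths are balanced, hence
    a permutation [s] of [l], and [s (base v)] and [h v] serve as coordinates. *)
Lemma layered_iso (l : 'I_m -> nat) : balanced (n - m) l ->
  isomorphic H (paths_on_clique l).
Proof.
move=> bl; have [s sE] := balanced_perm bl column_balanced.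
apply: (@isomorphic_paths_on_clique _ _ H (fun v => s (base v)) h).
- by move=> v; rewrite -sE.
- by move=> u v /perm_inj; exact: base_inj.
- rewrite card_ord; case: bl => sum_l _.
  under eq_bigr do rewrite -addn1.
  by rewrite big_split /= sum_l sum1_card card_ord subnK.
move=> u v; rewrite (inj_eq perm_inj).
wlog le_h : u v / h u <= h v.
  by move=> ih; case: (leqP (h u) (h v)) => [|/ltnW] /ih // E;
    rewrite /= e_sym [LHS]E eq_sym orbC andbC.
move: le_h; rewrite leq_eqVlt => /predU1P[h_eq|lt_h].
  rewrite h_eq andbb ltn_eqF //=; have [b_eq|b_neq] := eqVneq (base u) (base v).
    by rewrite (base_inj b_eq h_eq) e_irrefl.
  have uv_neq : u != v by apply: contra_neq b_neq => ->.
  have [hv0|hv0] := posnP (h v).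
    rewrite bottom_clique // ltnNge -h_gt0 ?hv0 // h_eq hv0 //.
  by apply/negP => /layer_stable/(_ h_eq); rewrite ltnNge -h_gt0 h_eq hv0.
have mv : m <= v by rewrite -h_gt0; apply: leq_ltn_trans lt_h.
have h_par : (h (par v)).+1 = h v := par_layer mv.
have b_par : base (par v) = base v.
  by apply: (base_iter (j := 1)); rewrite -h_par.
rewrite /= parE //; have [->|u_par] := eqVneq u (par v).
  by rewrite b_par eqxx h_par eqxx orbT.
have [b_eq|_] := eqVneq (base u) (base v); last by rewrite (gtn_eqF (leq_trans _ lt_h)) // andbF.
apply/esym/negP => /orP[/eqP|/eqP] E; first by lia.
case/eqP: u_par; apply: base_inj; first by rewrite b_par.
lia.
Qed.

End Layered.

(** * Graphs attaining the edge bounds *)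

Section EdgeCount.
Variable G : sgraph.
Implicit Types (I J : {set G}) (u v : G).

Definition valency_in u J := #|[set v in J | adj u v]|.

Lemma edge_countC I J : edge_count I J = edge_count J I.
Proof.
rewrite /edge_count; under eq_bigr do rewrite -sum1dep_card big_mkcondr /=.
rewrite exchange_big; apply: eq_bigr => v _; rewrite -sum1dep_card big_mkcondr /=.
by apply: eq_bigr => u _; rewrite adj_sym.
Qed.

Lemma edge_countU I1 I2 J : [disjoint I1 & I2] ->
  edge_count (I1 :|: I2) J = edge_count I1 J + edge_count I2 J.
Proof.
by move=> dis; rewrite /edge_count (eq_bigl _ _ (fun u => in_setU u I1 I2)) bigU.
Qed.

Lemma edge_count1 u J : edge_count [set u] J = valency_in u J.
Proof. by rewrite /edge_count big_set1. Qed.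

Lemma valency_in_gt0 u v J : adj u v -> v \in J -> 0 < valency_in u J.
Proof. by move=> uv vJ; apply/card_gt0P; exists v; rewrite inE vJ. Qed.

Lemma edge_count_eq0 I J u v : edge_count I J = 0 -> u \in I -> v \in J -> ~~ adj u v.
Proof.
move=> /eqP; rewrite sum_nat_eq0 => /forall_inP I0 /I0 u0 vJ; apply/negP => uv.
by have := valency_in_gt0 uv vJ; rewrite /valency_in (eqP u0).
Qed.

End EdgeCount.

Lemma star_count_high m i j : m <= i -> m <= j ->
  star_count m i j = m * m.-1 + minn i (j - m) + (i - m).
Proof. by move=> /minn_idPr mi /minn_idPr mj; rewrite /star_count mi mj. Qed.

Section Layers.
Variables (m n : nat) (e : rel 'I_n) (e_sym : symmetric e) (e_irrefl : irreflexive e).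
Local Notation H := (SGraph e_sym e_irrefl).
Local Notation T := (initial n : nat -> {set H}).

Hypotheses (m_gt1 : 1 < m) (le_mn : m <= n) (H_star : star_bounded m H).
(** The sizes allowed here are those at which the sorted eigenvector will be shown to drop
    strictly. *)
Hypothesis H_tight : forall a b, a <= b <= n -> (m %| a) || (a == n) ->
  (m %| b) || (b == n) -> edge_count (T a) (T b) = star_count m a b.

Let m_gt0 : 0 < m. Proof. exact: ltnW. Qed.

Let h (v : H) := v %/ m.
Let below j := T (j * m).
(** The minimum with [n] accounts for an incomplete last layer. *)
Let top j := minn (j.+1 * m) n.
Let layer j : {set H} := T (top j) :\: below j.

Let below_le (v : H) : h v * m <= v. Proof. exact: leq_divM. Qed.
Let below_lt (v : H) : h v * m < n. Proof. exact: leq_ltn_trans (ltn_ord v). Qed.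

Let in_below (v : H) j : (v \in below j) = (h v < j).
Proof. by rewrite inE ltn_divLR. Qed.

Let in_layer (v : H) j : (v \in layer j) = (h v == j).
Proof.
rewrite inE in_below inE /= leq_min ltn_ord andbT -leqNgt -ltn_divLR // ltnS.
by rewrite eqn_leq andbC.
Qed.

Let below_top j : j * m < n -> j * m <= top j <= n.
Proof. by move=> lt_n; rewrite geq_minr andbT leq_min leq_mul2r leqnSn orbT ltnW. Qed.

Let top_split j : j * m < n -> T (top j) = below j :|: layer j.
Proof.
move=> /below_top/andP[le_top _]; apply/setP => v; rewrite !inE.
by case: (ltnP v (j * m)) => //= lt_v; rewrite (leq_trans lt_v).
Qed.

Let disjoint_layer j : [disjoint below j & layer j].
Proof. by rewrite disjoint_sym disjoints_subset subsetDr. Qed.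

Let div_top j : (m %| top j) || (top j == n).
Proof.
by rewrite /top; case: leqP => _; rewrite ?eqxx ?orbT // dvdn_mull.
Qed.

Let div_below j : (m %| j * m) || (j * m == n). Proof. by rewrite dvdn_mull. Qed.

Let card_layer j : j * m < n -> #|layer j| = top j - j * m.
Proof.
move=> lt_n; have /andP[le_t le_n] := below_top lt_n.
rewrite cardsD (setIidPr _); last exact: initial_sub.
by rewrite !card_initial // ltnW.
Qed.

Let tight_below i j : i <= j -> j * m < n ->
  edge_count (below i) (below j) = star_count m (i * m) (j * m).
Proof. by move=> le_ij lt_n; rewrite H_tight ?div_below // leq_mul2r le_ij orbT ltnW. Qed.

Let tight_below_top i j : i <= j -> j * m < n ->
  edge_count (below i) (below j :|: layer j) = star_count m (i * m) (top j).
Proof.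
move=> le_ij lt_n; have /andP[le_t le_n] := below_top lt_n.
by rewrite -top_split // H_tight ?div_below // le_n (leq_trans _ le_t) // leq_mul2r le_ij orbT.
Qed.

Let tight_top j : j * m < n ->
  edge_count (below j :|: layer j) (below j :|: layer j) = star_count m (top j) (top j).
Proof.
by move=> lt_n; have /andP[_ le_n] := below_top lt_n; rewrite -top_split // H_tight ?leqnn.
Qed.

Let top_le j : top j <= j * m + m.
Proof. by rewrite geq_min mulSn addnC leqnn. Qed.

Let count_layer_below j : 0 < j -> j * m < n ->
  edge_count (layer j) (below j) = #|layer j|.
Proof.
move=> j_gt0 lt_n; have /andP[le_t le_n] := below_top lt_n.
have := tight_below_top (leqnn j) lt_n.
rewrite edge_countC edge_countU // tight_below // card_layer //.
have le_m : m <= j * m by rewrite leq_pmull.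
have le_tm : m <= top j by exact: leq_trans le_t.
by have := top_le j; rewrite !star_count_high //; lia.
Qed.

(** Adding the layer to [below j] raises the tight count by [2 * #|layer j|], and the edges down to
    [below j], counted in both directions, already account for this. *)
Let count_layer_layer j : 0 < j -> j * m < n -> edge_count (layer j) (layer j) = 0.
Proof.
move=> j_gt0 lt_n; have /andP[le_t le_n] := below_top lt_n.
have := tight_top lt_n; rewrite edge_countU // ![edge_count _ (_ :|: _)]edge_countC.
rewrite !edge_countU // [edge_count (below j) (layer j)]edge_countC.
rewrite count_layer_below // card_layer // tight_below //.
have le_m : m <= j * m by rewrite leq_pmull.
have le_tm : m <= top j by exact: leq_trans le_t.
by have := top_le j; rewrite !star_count_high //; lia.
Qed.

(** The tight counts from [below j] to the segments ending at [j.+1 * m] and at [top j.+1] agree,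
    because the minimum in [star_count] has already reached [j * m]. *)
Let count_layer_deep j : j.+1 * m < n -> edge_count (layer j.+1) (below j) = 0.
Proof.
move=> lt_n; have /andP[le_t le_n] := below_top lt_n.
have [->|j_gt0] := posnP j.
  by rewrite edge_countC /edge_count big1 // => v; rewrite in_below.
have := tight_below_top (leqnSn j) lt_n.
rewrite edge_countC edge_countU // [edge_count (below _) _]edge_countC tight_below //.
have le_b : j * m <= j.+1 * m by rewrite leq_mul2r leqnSn orbT.
have le_m : m <= j * m by rewrite leq_pmull.
have := mulSn j m; have le_m1 := leq_trans le_m le_b; have le_tm := leq_trans le_m1 le_t.
by rewrite !star_count_high //; lia.
Qed.

(** Adding [v] to the tight lower segment adds twice its valency there, while the bound grows by
    2. *)
Let valency_below_le1 (v : H) : 0 < h v -> valency_in v (below (h v)) <= 1.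
Proof.
move=> h_gt0; set B := below (h v).
have vB : [disjoint B & [set v]] by rewrite disjoint_sym disjoints1 in_below ltnn.
have := H_star (subxx (B :|: [set v])).
rewrite edge_countU // ![edge_count _ (_ :|: _)]edge_countC !edge_countU //.
rewrite [edge_count B [set v]]edge_countC !edge_count1.
have -> : valency_in v [set v] = 0.
  by apply: eq_card0 => w; rewrite !inE; case: eqP => //= ->; rewrite e_irrefl.
rewrite (tight_below (leqnn (h v)) (below_lt v)).
rewrite setUC cardsU1 in_below ltnn card_initial ?(ltnW (below_lt v)) // add1n.
have le_m : m <= h v * m by rewrite leq_pmull.
rewrite !star_count_high ?(leqW le_m) //; lia.
Qed.

(** The valencies into [below (h v)] over a layer are at most 1 and sum to the size of the layer, so
    none is 0. *)
Let valency_below (v : H) : 0 < h v -> valency_in v (below (h v)) = 1.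
Proof.
move=> h_gt0; apply/eqP; rewrite eqn_leq valency_below_le1 //= lt0n.
apply/negP => /eqP v0; have := count_layer_below h_gt0 (below_lt v).
rewrite /edge_count (bigD1 v) ?in_layer //= -/(valency_in v _) v0 add0n.
rewrite (cardsD1 v) in_layer eqxx -sum1_card => E.
have : \sum_(i in layer (h v) | i != v) #|[set v0 in below (h v) | e i v0]|
    <= \sum_(i in layer (h v) :\ v) 1.
  rewrite [X in _ <= X](eq_bigl (fun i => (i \in layer (h v)) && (i != v))); last first.
    by move=> i; rewrite in_setD1 andbC.
  apply: leq_sum => i /andP[]; rewrite in_layer => /eqP hi _.
  by have := @valency_below_le1 i; rewrite hi; apply.
by rewrite [X in X <= _]E add1n ltnn.
Qed.

Let clique_bottom (u v : H) : u < m -> v < m -> u != v -> adj u v.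
Proof.
move=> um vm uv; have := H_tight (a := m) (b := m); rewrite leqnn le_mn dvdnn.
move=> /(_ isT isT isT); rewrite star_count_high // !subnn minn0 !addn0.
have v_le (w : H) : w < m -> valency_in w (T m) <= m.-1 ?= iff
    ([set x in T m | adj w x] == T m :\ w).
  move=> wm; have -> : m.-1 = #|T m :\ w|.
    by have := cardsD1 w (T m); rewrite inE wm card_initial // => /(congr1 predn).
  apply: subset_leqif_cards; apply/subsetP => x; rewrite !inE => /andP[-> wx].
  by rewrite andbT; apply: contraTneq wx => ->; rewrite /= e_irrefl.
move=> E; have um' : u \in T m by rewrite inE.
have /eqP/setP/(_ v) : [set x in T m | adj u x] == T m :\ u.
  rewrite -(v_le u um); apply/negPn/negP => lt_u.
  have : edge_count (T m) (T m) < \sum_(w in T m) m.-1.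
    rewrite /edge_count (bigD1 u) //= [X in _ < X](bigD1 u) //= -addSn leq_add //.
      by rewrite ltn_neqAle lt_u v_le.
    by apply: leq_sum => w /andP[]; rewrite inE => wm _; apply: v_le.
  by rewrite E sum_nat_const card_initial // ltnn.
by rewrite !inE vm eq_sym uv /=.
Qed.

(** Adding [v] to the tight lower segment, counted against all vertices, raises the bound by at most
    [m] in the bottom layer and by at most 2 above it. *)
Let valency_le (v : H) : valency_in v setT <= if h v == 0 then m else 2.
Proof.
have TnT : T n = setT by apply/setP => w; rewrite !inE ltn_ord.
set B := below (h v).
have vB : [disjoint B & [set v]] by rewrite disjoint_sym disjoints1 in_below ltnn.
have := H_star (subsetT (B :|: [set v])).
rewrite edge_countU // edge_count1 -TnT.
have -> : edge_count B (T n) = star_count m (h v * m) n.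
  by apply: H_tight; rewrite ?div_below ?eqxx ?orbT // leqnn ltnW.
rewrite setUC cardsU1 in_below ltnn !card_initial ?(ltnW (below_lt v)) // add1n.
case: eqP => [->|/eqP]; rewrite ?mul0n -?lt0n.
  by rewrite /star_count (minn_idPr le_mn) min0n (minn_idPl m_gt0); lia.
move=> h_gt0; have le_m : m <= h v * m by rewrite leq_pmull.
rewrite !star_count_high ?(leqW le_m) //; lia.
Qed.

(** The default [v] is only taken when there is no lower neighbour, which [par_spec] excludes for
    [m <= v]. *)
Let par (v : 'I_n) : 'I_n := odflt v [pick u in below (h v) | e v u].

Let par_spec (v : 'I_n) : m <= v -> [set u in below (h v) | e v u] = [set par v].
Proof.
move=> mv; have h_gt0 : 0 < h v by rewrite divn_gt0.
have /eqP/cards1P[w E] := valency_below h_gt0.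
rewrite [LHS]E /par; case: pickP => [u /=|/(_ w) /=].
  by move=> uP; have : u \in [set w] by [rewrite -E inE]; rewrite inE => /eqP->.
by have : w \in [set w] by [rewrite inE]; rewrite -{1}E inE => ->.
Qed.

Lemma tight_iso (l : 'I_m -> nat) : balanced (n - m) l ->
  isomorphic H (paths_on_clique l).
Proof.
have h_gt0 (v : 'I_n) : (0 < h v) = (m <= v) by rewrite divn_gt0.
have par_mem (v : 'I_n) : m <= v -> (par v \in below (h v)) && e v (par v).
  move=> mv; have : par v \in [set par v] by rewrite inE.
  by rewrite -par_spec // inE.
have par_h (v : 'I_n) : m <= v -> (h (par v)).+1 = h v.
  move=> mv; have /andP[p_b vp] := par_mem v mv; apply/eqP.
  rewrite in_below in p_b; rewrite eqn_leq p_b /= leqNgt; apply/negP => lt_h.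
  case Eh: (h v) lt_h p_b => [|j] // lt_h _.
  have lt_n : j.+1 * m < n by rewrite -Eh.
  have := @edge_count_eq0 H _ _ v (par v) (count_layer_deep lt_n).
  by rewrite in_layer Eh eqxx in_below /= vp -ltnS lt_h => /(_ isT isT).
apply: (@layered_iso _ _ _ _ _ par) => //.
- move=> u v uv h_eq; rewrite ltnNge -h_gt0; apply/negP => hu_gt0.
  have := @edge_count_eq0 H _ _ u v (count_layer_layer hu_gt0 (below_lt u)).
  by rewrite !in_layer eqxx /h -h_eq eqxx /= uv => /(_ isT isT).
- move=> u v lt_h; have mv : m <= v by rewrite -h_gt0; apply: leq_ltn_trans lt_h.
  have /setP/(_ u) := par_spec mv; rewrite in_set1 inE in_below.
  by rewrite [h u < h v]lt_h /= e_sym.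
- move=> u v mu h_eq p_eq; apply/eqP/negPn/negP => uv.
  have mv : m <= v by rewrite -h_gt0 /h -h_eq h_gt0.
  have /andP[pu up] := par_mem u mu; have /andP[pv vp] := par_mem v mv.
  set w := par u; have h_w := par_h u mu.
  (* Two children sharing the parent [w] would be too many: [w] has [m - 1] further neighbours if it
     lies in the bottom clique and at least one otherwise, against [valency_le]. *)
  have : 2 + valency_in (w : H) (below (h u)) <= valency_in (w : H) setT.
    have -> : 2 = #|[set u; v]| by rewrite cards2 uv.
    rewrite -cardsUI (_ : _ :&: _ = set0) ?cards0 ?addn0; last first.
      apply/setP => x; rewrite !inE; case: eqP => [->|_] /=.
        by rewrite ltnNge below_le.
      by case: eqP => [->|] //=; rewrite /h h_eq ltnNge (below_le v).
    apply/subset_leq_card/subsetP => x; rewrite !inE => /orP[/orP[]/eqP->|/andP[]//].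
      by rewrite /w /= e_sym.
    by rewrite /w p_eq /= e_sym.
  have := valency_le w; case: eqP => [w0|/eqP w_neq0].
    have -> : below (h u) = T m by rewrite -h_w w0 /below mul1n.
    have -> : valency_in (w : H) (T m) = m.-1.
      have wm : w < m by rewrite ltnNge -h_gt0 w0.
      rewrite -[in RHS](@card_initial n m) // (cardsD1 (w : 'I_n)) inE wm /=.
      apply: eq_card => x; rewrite !inE; have [xm|_] := ltnP x m; last by rewrite andbF.
      have [->|xw] := eqVneq; first by rewrite /= e_irrefl.
      by apply: clique_bottom; rewrite // eq_sym.
    by move: m_gt0; lia.
  rewrite -lt0n in w_neq0; have := valency_below w_neq0.
  have : valency_in (w : H) (below (h w)) <= valency_in (w : H) (below (h u)).
    apply/subset_leq_card/subsetP => x; rewrite !inE => /andP[lt_x ->].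
    by rewrite andbT (leq_trans lt_x) // leq_mul2r -h_w leqnSn orbT.
  lia.
Qed.

End Layers.

Lemma clique_chains_iso m n (l : 'I_m -> nat) : 0 < m -> m <= n ->
  balanced (n - m) l -> isomorphic (clique_chains m n) (paths_on_clique l).
Proof.
move=> m_gt0 le_mn; pose par (v : 'I_n) : 'I_n := Ordinal (leq_ltn_trans (leq_subr m v) (ltn_ord v)).
have h_gt0 (v : 'I_n) : (0 < v %/ m) = (m <= v) by rewrite divn_gt0.
have par_h (v : 'I_n) : m <= v -> (par v %/ m).+1 = v %/ m.
  by move=> mv; rewrite -[in RHS](subnK mv) divnDr ?dvdnn // divnn m_gt0 addn1.
have adj_down (u v : 'I_n) : u = v + m :> nat -> u %/ m = (v %/ m).+1.
  by move=> ->; rewrite divnDr ?dvdnn // divnn m_gt0 addn1.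
apply: (@layered_iso _ _ _ _ _ par) => //.
- by move=> u v um vm uv; rewrite /clique_chains_adj uv um vm.
- move=> u v /andP[_ /or3P[/andP[]//|/eqP/adj_down->|/eqP/adj_down->]] => [/esym|];
    by move/n_Sn.
- move=> u v lt_h; have mv : m <= v by rewrite -h_gt0; apply: leq_ltn_trans lt_h.
  have uv : u < v by rewrite ltnNge; apply/negP => /(leq_div2r m); rewrite leqNgt lt_h.
  rewrite /clique_chains_adj -!val_eqE /= ltn_eqF //=.
  have -> : (v < m) = false by rewrite ltnNge mv.
  by rewrite andbF /= (ltn_eqF (ltn_addr _ uv)) /=; lia.
- by move=> u v mu h_eq [] E; apply: val_inj => /=; have := h_gt0 v; rewrite -h_eq h_gt0; lia.
Qed.

Local Open Scope ring_scope.

(** * Spectral radii as Rayleigh quotients *)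

Section SpectralRadius.
Variables (R : realType) (p : nat) (M : 'M[R]_p).

Local Notation MC := (map_mx (real_complex R) M).
Local Notation normc := Normc.normc.
Local Open Scope complex_scope.

Lemma real_complex_normc (z : R[i]) : (normc z)%:C = `|z|.
Proof. by []. Qed.

Lemma conj_real_complex (x : R) : Num.conj (x%:C : R[i]) = x%:C.
Proof. exact: (conjc_real x). Qed.

(** The eigenvalues are the finitely many roots of the characteristic polynomial, so the supremum is
    reached. *)
Lemma spectral_radius_attained : (0 < p)%N ->
  exists z, [/\ eigenvalue MC z, spectral_radius M = normc z &
    forall z', eigenvalue MC z' -> normc z' <= normc z].
Proof.
move=> p_gt0.
have [rs Ers] := closed_field_poly_normal (char_poly MC).
have eigE z : eigenvalue MC z = (z \in rs).
  rewrite eigenvalue_root_char Ers (monicP (char_poly_monic _)) scale1r.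
  by rewrite root_prod_XsubC.
have [z0 z0P] := eigenvalue_closed MC p_gt0.
have rs_gt0 : (0 < size rs)%N by rewrite -has_predT; apply/hasP; exists z0; rewrite -?eigE.
case: (@arg_maxP _ R _ (Ordinal rs_gt0) xpredT (fun i : 'I__ => normc rs`_i)) => // i _ imax.
have zP : eigenvalue MC rs`_i by rewrite eigE mem_nth.
have zmax z' : eigenvalue MC z' -> normc z' <= normc rs`_i.
  rewrite eigE => z'rs; have lt_z' : (index z' rs < size rs)%N by rewrite index_mem.
  by have := imax (Ordinal lt_z') isT; rewrite /= nth_index.
have S_ub : ubound [set normc z | z in [set z | eigenvalue MC z]]%classic (normc rs`_i).
  by move=> _ [z /= /zmax ? <-].
exists rs`_i; split; [exact: zP | | exact: zmax].
apply: le_anti; apply/andP; split.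
  by apply: (@ge_sup R) S_ub; exists (normc z0); exists z0; first exact: z0P.
by apply: (@ub_le_sup R); [exists (normc rs`_i) | exists rs`_i; first exact: zP].
Qed.

Hypothesis M_ge0 : forall i j, 0 <= M i j.

(** The moduli of the entries of a left eigenvector for an eigenvalue of largest modulus satisfy
    this, by the triangle inequality. *)
Lemma spectral_radius_subinvariant : (0 < p)%N ->
  exists x : 'I_p -> R, [/\ forall i, 0 <= x i, exists i, x i != 0 &
    forall j, spectral_radius M * x j <= \sum_i M i j * x i].
Proof.
move=> /spectral_radius_attained[z [/eigenvalueP[v vE v_neq0] -> _]].
exists (fun i => normc (v 0 i)); split.
- by move=> i; rewrite -lecR real_complex_normc normr_ge0.
- have /rV0Pn[i vi] := v_neq0; exists i; apply: contra vi => /eqP.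
  by move/Normc.eq0_normc->.
move=> j; have /rowP/(_ j) := vE; rewrite !mxE => Ej.
rewrite -lecR rmorphM /= !real_complex_normc -normrM -Ej.
apply: (le_trans (ler_norm_sum _ _ _)).
rewrite rmorph_sum /= ler_sum // => i _; rewrite !mxE normrM rmorphM /=.
rewrite real_complex_normc mulrC ler_wpM2r //.
by rewrite ger0_norm // (_ : 0 = 0%:C) // lecR.
Qed.

Hypothesis M_sym : M^T = M.

(** In the coordinates [w] of a unitary diagonalisation the form is the sum of [d 0 i] times the
    squared modulus of [w 0 i], the norm is preserved, and each [d 0 i] is an eigenvalue. *)
Lemma rayleigh_le_spectral_radius (x : 'I_p -> R) :
  \sum_i \sum_j M i j * x i * x j <= spectral_radius M * \sum_i x i ^+ 2.
Proof.
have [p_eq0|p_gt0] := posnP p.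
  have e0 (F : 'I_p -> R) : \sum_i F i = 0.
    by apply: big1 => -[i lt_i]; exfalso; rewrite p_eq0 in lt_i.
  by rewrite !e0 mulr0.
have [z [_ -> zmax]] := spectral_radius_attained p_gt0.
set P := spectralmx MC; set d := spectral_diag MC.
have MC_normal : MC \is normalmx.
  apply: hermitian_normalmx; apply/is_hermitianmxP.
  rewrite expr0 scale1r; apply/matrixP=> i j; rewrite !mxE.
  by rewrite -{1}M_sym mxE conj_real_complex.
have MCE : MC = invmx P *m diag_mx d *m P by apply/orthomx_spectralP.
have Pu : P \is unitarymx := spectral_unitarymx _.
have PV : invmx P = (P^T ^ Num.conj)%sesqui by exact: invmx_unitary.
have d_le i : normc (d 0 i) <= normc z.
  apply: zmax; apply/eigenvalueP; exists (row i P).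
    rewrite {1}MCE -row_mul !mulmxA mulmxV ?spectral_unit // mul1mx.
    by rewrite row_mul row_diag_mx -scalemxAl -rowE.
  apply/negP => /eqP rP0; have /row_unitarymxP/(_ i i) := Pu.
  rewrite rP0 eqxx dotmxE mul0mx mxE => /eqP.
  by rewrite eq_sym oner_eq0.
pose u : 'rV[R[i]]_p := \row_i (x i)%:C.
pose w := u *m invmx P.
have uJ : (u^T ^ Num.conj)%sesqui = u^T.
  by apply/matrixP=> i j; rewrite !mxE conj_real_complex.
have wJ : P *m u^T = (w^T ^ Num.conj)%sesqui.
  rewrite /w trmx_mul map_mxM uJ PV; congr (_ *m _).
  by apply/matrixP=> i j; rewrite !mxE; exact/esym/conjCK.
have quadE : u *m MC *m u^T = w *m diag_mx d *m (w^T ^ Num.conj)%sesqui.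
  by rewrite -wJ {1}MCE /w !mulmxA.
have normE : u *m u^T = w *m (w^T ^ Num.conj)%sesqui.
  by rewrite -wJ /w !mulmxA mulmxKV // spectral_unit.
have quadE00 : (\sum_i \sum_j M i j * x i * x j)%:C =
    \sum_i d 0 i * `|w 0 i| ^+ 2.
  have /matrixP/(_ 0 0) := quadE.
  rewrite mul_mx_diag !mxE => E; apply: etrans (etrans E _).
    rewrite exchange_big rmorph_sum /=; apply: eq_bigr => j _.
    rewrite !mxE rmorph_sum mulr_suml; apply: eq_bigr => i _.
    by rewrite !mxE !rmorphM /=; ring.
  by apply: eq_bigr => i _; rewrite !mxE normCK; ring.
have normE00 : (\sum_i x i ^+ 2)%:C = \sum_i `|w 0 i| ^+ 2.
  have /matrixP/(_ 0 0) := normE.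
  rewrite !mxE => E; apply: etrans (etrans E _).
    by rewrite rmorph_sum; apply: eq_bigr => i _; rewrite !mxE rmorphXn.
  by apply: eq_bigr => i _; rewrite !mxE normCK.
rewrite -lecR; apply: le_trans (_ : `|(\sum_i \sum_j M i j * x i * x j)%:C| <= _).
  rewrite -[X in _ <= X]real_complex_normc lecR /= expr0n addr0 sqrtr_sqr.
  exact: ler_norm.
rewrite quadE00 rmorphM /= normE00 mulr_sumr.
apply: (le_trans (ler_norm_sum _ _ _)); apply: ler_sum => i _.
rewrite normrM normrX normr_id ler_wpM2r ?exprn_ge0 //.
by rewrite -!real_complex_normc lecR.
Qed.

Lemma rayleigh_eq_eigen (x : 'I_p -> R) :
  \sum_i \sum_j M i j * x i * x j = spectral_radius M * \sum_i x i ^+ 2 ->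
  forall i, \sum_j M i j * x j = spectral_radius M * x i.
Proof.
set rho := spectral_radius M => eq_x i0.
pose g i := \sum_j M i j * x j - rho * x i.
suff g0 : g i0 = 0 by apply/eqP; rewrite -subr_eq0 -/(g i0) g0.
have Mij i j : M i j = M j i by rewrite -{1}M_sym mxE.
(* Moving [x] along the coordinate [i0] by [t] changes the nonpositive defect
   from [0] to [2 t g i0 + t ^ 2 c], which forces [g i0 = 0]. *)
pose c := M i0 i0 - rho.
have quad t : 2 * t * g i0 + t ^+ 2 * c <= 0.
  have := rayleigh_le_spectral_radius (fun i => x i + t * (i == i0)%:R).
  have e1 (F : 'I_p -> R) : \sum_i F i * (i == i0)%:R = F i0.
    rewrite (bigD1 i0) //= eqxx mulr1 big1 ?addr0 // => j /negPf->.
    by rewrite mulr0.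
  have -> : \sum_i (x i + t * (i == i0)%:R) ^+ 2 =
      \sum_i x i ^+ 2 + 2 * t * x i0 + t ^+ 2.
    rewrite -(e1 (fun i => 2 * t * x i)) -[t ^+ 2](e1 (fun=> t ^+ 2)).
    rewrite -!big_split /=; apply: eq_bigr => i _.
    by case: (i == i0) => /=; ring.
  have -> : \sum_i \sum_j M i j * (x i + t * (i == i0)%:R) *
       (x j + t * (j == i0)%:R) =
      \sum_i \sum_j M i j * x i * x j + 2 * t * (\sum_j M i0 j * x j)
      + t ^+ 2 * M i0 i0.
    rewrite -(e1 (fun i => t ^+ 2 * M i i0)).
    rewrite (_ : 2 * t * _ = t * \sum_i M i i0 * x i + \sum_i
      (t * \sum_j M i j * x j) * (i == i0)%:R); last first.
      rewrite e1 /= (_ : \sum_i M i i0 * x i = \sum_j M i0 j * x j); first by ring.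
      by apply: eq_bigr => j _; rewrite Mij.
    rewrite mulr_sumr -!big_split /=; apply: eq_bigr => i _.
    rewrite -(e1 (fun j => t * (M i j * x i))) -[t ^+ 2 * _](e1 (fun j => t ^+ 2 * M i j)).
    rewrite mulr_sumr !mulr_suml -!big_split /=; apply: eq_bigr => j _ /=.
    by ring.
  rewrite eq_x /g /c -/rho; set s := \sum_i _ ^+ 2.
  set q := \sum_j _ => le_q; rewrite -subr_ge0 in le_q; rewrite -oppr_ge0.
  by apply: le_trans le_q _; rewrite le_eqVlt; apply/orP; left; apply/eqP; ring.
have [//|g_neq0] := eqVneq (g i0) 0.
have c1_gt0 : 0 < 1 + `|c| by rewrite ltr_pwDl // normr_ge0.
(* For this [t] the quadratic expression has the sign of [2 * (1 + |c|) + c], which is positive. *)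
have := quad (g i0 / (1 + `|c|)).
have g2_gt0 : 0 < g i0 ^+ 2 by rewrite exprn_even_gt0.
rewrite (_ : _ + _ = g i0 ^+ 2 / (1 + `|c|) ^+ 2 * (2 * (1 + `|c|) + c)); last first.
  by field; rewrite gt_eqF.
rewrite leNgt mulr_gt0 //; first by rewrite divr_gt0 // exprn_gt0.
have : - `|c| <= c by rewrite lerNl ler_normr lexx orbT.
have := normr_ge0 c; move: `|c| (c) => a b ? ?; lra.
Qed.

(** Pairing the subinvariant vector with itself gives one inequality, the Rayleigh bound the other.
    This yields a nonnegative maximiser without irreducibility. *)
Lemma spectral_radius_eigenvector : (0 < p)%N ->
  exists x : 'I_p -> R, [/\ forall i, 0 <= x i, exists i, x i != 0 &
    \sum_i \sum_j M i j * x i * x j = spectral_radius M * \sum_i x i ^+ 2].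
Proof.
move=> /spectral_radius_subinvariant[x [x_ge0 x_neq0 xE]]; exists x; split=> //.
apply: le_anti; rewrite rayleigh_le_spectral_radius exchange_big mulr_sumr /=.
apply: ler_sum => j _; rewrite expr2 mulrA -mulr_suml.
by rewrite ler_wpM2r.
Qed.

End SpectralRadius.

(** * The quadratic form of the alpha matrix *)

Section AlphaForm.
Variables (R : realType) (alpha : R).

(** The degree term is spread over the incident edges, so that the whole form is a sum over ordered
    adjacent pairs. *)
Definition alpha_form (G : sgraph) (x : G -> R) : R :=
  \sum_u \sum_v (adj u v)%:R * (alpha * x u ^+ 2 + (1 - alpha) * (x u * x v)).

Section Graph.
Variable G : sgraph.

Local Notation rho := (alpha_radius G alpha).
Local Notation M := (alpha_mx G alpha).

Lemma sum_enum_val (F : G -> R) :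
  \sum_(i < #|G|) F (enum_val i) = \sum_(u : G) F u.
Proof. by rewrite (reindex _ (onW_bij _ (enum_val_bij G))). Qed.

Lemma alpha_mxE i j : M i j =
  alpha * ((i == j)%:R * \sum_v (adj (enum_val i) v)%:R) +
  (1 - alpha) * (adj (enum_val i) (enum_val j))%:R.
Proof.
rewrite !mxE; congr (alpha * _ + _); rewrite mulr_natl.
case: eqP => [_|_]; last by rewrite !mulr0n.
rewrite !mulr1n /degree -sum1dep_card natr_sum big_mkcond /=.
by apply: eq_bigr => v _; case: adj.
Qed.

Lemma alpha_mx_ge0 i j : 0 <= alpha <= 1 -> 0 <= M i j.
Proof.
case/andP=> a_ge0 a_le1; rewrite alpha_mxE addr_ge0 // mulr_ge0 ?subr_ge0 //.
by rewrite mulr_ge0 // sumr_ge0.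
Qed.

Lemma tr_alpha_mx : M^T = M.
Proof.
apply/matrixP=> i j; rewrite mxE !alpha_mxE adj_sym eq_sym.
by case: eqP => [->|_] //; rewrite !mul0r.
Qed.

Lemma alpha_mx_row (x : G -> R) i : \sum_j M i j * x (enum_val j) =
  \sum_v (adj (enum_val i) v)%:R * (alpha * x (enum_val i) + (1 - alpha) * x v).
Proof.
under eq_bigr do rewrite alpha_mxE mulrDl.
rewrite big_split /= (bigD1 i) //= eqxx [X in _ + X + _]big1; last first.
  by move=> j /negPf; rewrite eq_sym => ->; rewrite mul0r mulr0 mul0r.
rewrite addr0 mul1r mulr_sumr mulr_suml.
rewrite (sum_enum_val (fun v => (1 - alpha) * (adj (enum_val i) v)%:R * x v)).
by rewrite -big_split; apply: eq_bigr => v _ /=; ring.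
Qed.

Lemma alpha_mx_form (x : G -> R) :
  \sum_i \sum_j M i j * x (enum_val i) * x (enum_val j) = alpha_form x.
Proof.
rewrite /alpha_form -sum_enum_val; apply: eq_bigr => i _.
rewrite (eq_bigr (fun j => x (enum_val i) * (M i j * x (enum_val j)))); last first.
  by move=> j _; ring.
rewrite -mulr_sumr alpha_mx_row mulr_sumr; apply: eq_bigr => v _; ring.
Qed.

Lemma alpha_form_le (x : G -> R) : alpha_form x <= rho * \sum_u x u ^+ 2.
Proof.
rewrite -alpha_mx_form -(sum_enum_val (fun u => x u ^+ 2)).
exact: (rayleigh_le_spectral_radius tr_alpha_mx (fun i => x (enum_val i))).
Qed.

Lemma alpha_form_eigen (x : G -> R) : alpha_form x = rho * \sum_u x u ^+ 2 ->
  forall u, \sum_v (adj u v)%:R * (alpha * x u + (1 - alpha) * x v) = rho * x u.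
Proof.
rewrite -alpha_mx_form -(sum_enum_val (fun u => x u ^+ 2)).
move=> /(rayleigh_eq_eigen tr_alpha_mx (x := fun i => x (enum_val i))) eig u.
by rewrite -[u in LHS]enum_rankK -alpha_mx_row eig enum_rankK.
Qed.

Lemma alpha_form_attained : 0 <= alpha <= 1 -> (0 < #|G|)%N ->
  exists x : G -> R, [/\ forall u, 0 <= x u, exists u, x u != 0 &
    alpha_form x = rho * \sum_u x u ^+ 2].
Proof.
move=> a01 G_gt0.
have M_ge0 i j : 0 <= M i j by exact: alpha_mx_ge0.
have [x [x_ge0 [i xi] xE]] := spectral_radius_eigenvector M_ge0 tr_alpha_mx G_gt0.
exists (fun u => x (enum_rank u)); split=> //.
  by exists (enum_val i); rewrite enum_valK.
rewrite -alpha_mx_form -(sum_enum_val (fun u => x (enum_rank u) ^+ 2)).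
under eq_bigr do under eq_bigr do rewrite !enum_valK.
by rewrite xE; under [in RHS]eq_bigr do rewrite enum_valK.
Qed.

(** Where [x] vanishes, the eigenvalue equation is a vanishing sum of nonnegative terms. As
    [alpha < 1], the neighbours vanish too, and connectivity spreads this to all vertices. *)
Lemma eigen_pos (x : G -> R) r : alpha < 1 -> 0 <= alpha -> connected_graph G ->
  (forall u, 0 <= x u) -> (exists u, x u != 0) ->
  (forall u, \sum_v (adj u v)%:R * (alpha * x u + (1 - alpha) * x v) = r * x u) ->
  forall u, 0 < x u.
Proof.
move=> a_lt1 a_ge0 /andP[_ /existsPn conn] x_ge0 [w xw] eig u.
rewrite lt_def x_ge0 andbT; apply: contra xw => xu0.
have /existsPn/(_ w) := conn u; rewrite negbK => /connectP[q].
elim: q u xu0 => [|v q IHq] u /= /eqP xu0; first by move=> _ ->; rewrite xu0.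
case/andP=> uv q_path; apply: IHq => //.
have /eqP := eig u; rewrite xu0 !mulr0 psumr_eq0 => [|v' _]; last first.
  by rewrite add0r !mulr_ge0 // subr_ge0 ltW.
move=> /allP/(_ v (mem_index_enum _)); rewrite uv add0r mul1r mulf_eq0.
by rewrite subr_eq0 (gt_eqF a_lt1).
Qed.

End Graph.

Lemma alpha_form_comp (G H : sgraph) (f : G -> H) (x : H -> R) : bijective f ->
  (forall u v, adj (f u) (f v) = adj u v) -> alpha_form (x \o f) = alpha_form x.
Proof.
move=> f_bij fadj; rewrite /alpha_form [RHS](reindex f (onW_bij _ f_bij)).
apply: eq_bigr => a _; rewrite [RHS](reindex f (onW_bij _ f_bij)).
by apply: eq_bigr => b _; rewrite /= fadj.
Qed.

Lemma alpha_radius_iso_le (G H : sgraph) : 0 <= alpha <= 1 -> (0 < #|G|)%N ->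
  isomorphic H G -> alpha_radius G alpha <= alpha_radius H alpha.
Proof.
move=> a01 G_gt0 [f [f_bij fadj]].
have [x [x_ge0 [u xu] xE]] := alpha_form_attained a01 G_gt0.
have := alpha_form_le (x \o f); rewrite alpha_form_comp // xE.
rewrite (_ : \sum_v _ = \sum_v x v ^+ 2); last first.
  by rewrite [RHS](reindex f (onW_bij _ f_bij)).
rewrite ler_pM2r // lt_def sumr_ge0 => [|v _]; last exact: sqr_ge0.
rewrite andbT psumr_neq0 => [|v _]; last exact: sqr_ge0.
by apply/hasP; exists u; rewrite ?mem_index_enum //= lt_def sqrf_eq0 xu sqr_ge0.
Qed.

End AlphaForm.

(** * Rearrangement *)

Section Abel.
Variables (R : realType) (n : nat).

(** Each value [u i] is the sum of the drops [u s - u s.+1] over [s >= i]; the drop at [s] belongs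
    to the initial segment of size [s.+1]. *)
Lemma abel_summation2 (c : 'I_n -> 'I_n -> R) (u w : nat -> R) :
  u n = 0 -> w n = 0 ->
  \sum_i \sum_j c i j * (u i * w j) =
  \sum_(s < n) \sum_(t < n) (u s - u s.+1) * (w t - w t.+1) *
     (\sum_(i in initial n s.+1) \sum_(j in initial n t.+1) c i j).
Proof.
have tele (v : nat -> R) (i : 'I_n) : v n = 0 ->
    v i = \sum_(s < n) (v s - v s.+1) * (i \in initial n s.+1)%:R.
  move=> vn0; rewrite -(big_mkord xpredT (fun s => (v s - v s.+1) *
    (i \in initial n s.+1)%:R)) (big_cat_nat _ (ltnW (ltn_ord i))) //=.
  rewrite big_nat big1 ?add0r => [|s /andP[_ lt_si]]; last first.
    by rewrite inE ltnS leqNgt lt_si mulr0.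
  rewrite (eq_big_nat _ _ (F2 := fun s => - (v s.+1 - v s))); last first.
    by move=> s /andP[le_is _]; rewrite inE ltnS le_is mulr1 opprB.
  by rewrite sumrN telescope_sumr 1?ltnW // vn0 sub0r opprK.
move=> un0 wn0.
transitivity (\sum_i \sum_j \sum_(s < n) \sum_(t < n)
  ((u s - u s.+1) * (w t - w t.+1)) *
     ((i \in initial n s.+1)%:R * ((j \in initial n t.+1)%:R * c i j))).
  apply: eq_bigr => i _; apply: eq_bigr => j _.
  rewrite (tele u i un0) (tele w j wn0) mulr_suml mulr_sumr; apply: eq_bigr => s _.
  by rewrite !mulr_sumr; apply: eq_bigr => t _; ring.
under eq_bigr do rewrite exchange_big /=.
rewrite exchange_big /=; apply: eq_bigr => s _.
under eq_bigr do rewrite exchange_big /=.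
rewrite exchange_big /=; apply: eq_bigr => t _.
rewrite mulr_sumr [RHS]big_mkcond /=; apply: eq_bigr => i _.
rewrite -mulr_sumr -mulr_sumr; case: ifP => i_s; rewrite ?mul0r ?mulr0 // mul1r.
congr (_ * _); rewrite [RHS]big_mkcond /=; apply: eq_bigr => j _.
by case: ifP; rewrite ?mul1r ?mul0r.
Qed.

End Abel.

Section Rearrangement.
Variables (R : realType) (alpha : R) (m n : nat).
Variables (e : rel 'I_n) (e_sym : symmetric e) (e_irrefl : irreflexive e).
Local Notation H := (SGraph e_sym e_irrefl).
Local Notation S := (clique_chains m n).
Variable y : nat -> R.

Hypotheses (m_gt0 : (0 < m)%N) (H_star : star_bounded m H).
Hypotheses (y_ge0 : forall i, 0 <= y i) (y_noninc : forall i, y i.+1 <= y i).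
Hypotheses (y_n : y n = 0) (alpha_ge0 : 0 <= alpha) (alpha_lt1 : alpha < 1).

Let c (i j : 'I_n) : R := (@adj S i j)%:R - (e i j)%:R.

Let excess s t := \sum_(i in initial n s) \sum_(j in initial n t) c i j.

Lemma edge_count_sum (G : sgraph) (I J : {set G}) :
  (edge_count I J)%:R = \sum_(i in I) \sum_(j in J) (adj i j)%:R :> R.
Proof.
rewrite /edge_count natr_sum; apply: eq_bigr => i _.
rewrite -sum1_card natr_sum [LHS]big_mkcond [RHS]big_mkcond.
by apply: eq_bigr => j _; rewrite inE; case: (j \in J); case: adj.
Qed.

Lemma excessE s t : (s <= t <= n)%N -> excess s t =
  (star_count m s t)%:R - (@edge_count H (initial n s) (initial n t))%:R.
Proof.
move=> st; rewrite -(edge_count_clique_chains m_gt0 st) !edge_count_sum /excess /c.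
by rewrite -sumrB; apply: eq_bigr => i _; rewrite -sumrB.
Qed.

Lemma excess_sym s t : excess s t = excess t s.
Proof.
rewrite /excess exchange_big /=; apply: eq_bigr => i _; apply: eq_bigr => j _.
by rewrite /c adj_sym e_sym.
Qed.

Lemma excess_ge0 s t : (s <= n)%N -> (t <= n)%N -> 0 <= excess s t.
Proof.
wlog le_st : s t / (s <= t)%N.
  by case: (leqP s t) => [|/ltnW] ? ih ? ?; [|rewrite excess_sym]; apply: ih.
move=> sn tn; rewrite excessE ?le_st // subr_ge0 ler_nat.
by have := H_star (initial_sub n le_st); rewrite !card_initial.
Qed.

(** The constant weight 1 of the degree term, cut off at [n] because summation by parts requires the
    value 0 there. *)
Let ind i : R := (i < n)%:R.

Lemma form_gap : alpha_form alpha (y : S -> R) - alpha_form alpha (y : H -> R) =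
  alpha * (\sum_(s < n) \sum_(t < n) (y s ^+ 2 - y s.+1 ^+ 2) * (ind t - ind t.+1)
     * excess s.+1 t.+1) +
  (1 - alpha) * (\sum_(s < n) \sum_(t < n) (y s - y s.+1) * (y t - y t.+1)
     * excess s.+1 t.+1).
Proof.
rewrite -(@abel_summation2 _ _ c (fun i => y i ^+ 2) ind) ?y_n ?expr0n //; last first.
  by rewrite /ind ltnn.
rewrite -abel_summation2 // /alpha_form -sumrB !mulr_sumr -big_split /=.
apply: eq_bigr => i _; rewrite -sumrB !mulr_sumr -big_split /=.
by apply: eq_bigr => j _; rewrite /c /ind ltn_ord /=; ring.
Qed.

Let term_ge0 (u w : nat -> R) (s t : 'I_n) : (forall i, u i.+1 <= u i) ->
  (forall i, w i.+1 <= w i) ->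
  0 <= (u s - u s.+1) * (w t - w t.+1) * excess s.+1 t.+1.
Proof. by move=> ? ?; rewrite !mulr_ge0 ?subr_ge0 // excess_ge0. Qed.

Let degree_gap_ge0 : 0 <= \sum_(s < n) \sum_(t < n)
  (y s ^+ 2 - y s.+1 ^+ 2) * (ind t - ind t.+1) * excess s.+1 t.+1.
Proof.
apply: sumr_ge0 => s _; apply: sumr_ge0 => t _; apply: (term_ge0 (u := fun i => y i ^+ 2)).
  by move=> i; rewrite ler_sqr ?nnegrE.
by move=> i; rewrite ler_nat; lia.
Qed.

Lemma form_le_clique_chains :
  alpha_form alpha (y : H -> R) <= alpha_form alpha (y : S -> R).
Proof.
rewrite -subr_ge0 form_gap addr_ge0 ?mulr_ge0 // ?subr_ge0 ?(ltW alpha_lt1) //.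
by apply: sumr_ge0 => s _; apply: sumr_ge0 => t _; exact: term_ge0.
Qed.

(** The gap is a sum of nonnegative terms, so equality kills each term of the adjacency part, whose
    factor [1 - alpha] is positive. Strict drops at [s] and [t] leave only the excess to vanish. *)
Lemma form_eq_edge_count :
  alpha_form alpha (y : H -> R) = alpha_form alpha (y : S -> R) ->
  forall s t, (s <= t < n)%N -> y s.+1 < y s -> y t.+1 < y t ->
  @edge_count H (initial n s.+1) (initial n t.+1) = star_count m s.+1 t.+1.
Proof.
move=> eq_form s t /andP[le_st lt_tn] y_s y_t.
have lt_sn := leq_ltn_trans le_st lt_tn.
pose F (s t : 'I_n) := (y s - y s.+1) * (y t - y t.+1) * excess s.+1 t.+1.
have F_ge0 s' t' : 0 <= F s' t' by exact: term_ge0.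
have sum_F : \sum_s \sum_t F s t = 0.
  have /eqP := form_gap; rewrite eq_form subrr eq_sym.
  have sumF_ge0 : 0 <= \sum_s \sum_t F s t.
    by rewrite sumr_ge0 // => s' _; rewrite sumr_ge0.
  rewrite paddr_eq0 ?mulr_ge0 ?subr_ge0 ?(ltW alpha_lt1) // => /andP[_].
  by rewrite mulf_eq0 subr_eq0 (gt_eqF alpha_lt1) => /eqP.
have F0 : F (Ordinal lt_sn) (Ordinal lt_tn) = 0.
  move: sum_F; rewrite pair_big /= => /eqP; rewrite psumr_eq0 // => /allP.
  by move=> /(_ (Ordinal lt_sn, Ordinal lt_tn) (mem_index_enum _))/eqP.
move: F0; rewrite /F /= => /eqP; rewrite !mulf_eq0 !(subr_eq0 (y _)).
rewrite (gt_eqF y_s) (gt_eqF y_t) /= excessE ?ltnS ?le_st // subr_eq0 eqr_nat.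
by move/eqP.
Qed.

End Rearrangement.

(** * Strict drops of the eigenvector between layers *)

Section Gaps.
Variables (R : realType) (alpha rho : R) (m n : nat) (y : nat -> R).
Local Notation S := (clique_chains m n).

Hypotheses (m_gt2 : (2 < m)%N) (y_gt0 : forall i, (i < n)%N -> 0 < y i).
Hypotheses (y_noninc : forall i, y i.+1 <= y i).
Hypotheses (alpha_ge0 : 0 <= alpha) (alpha_lt1 : alpha < 1).
Hypothesis y_eigen : forall u : S,
  \sum_(v : S) (adj u v)%:R * (alpha * y u + (1 - alpha) * y v) = rho * y u.

Let m_gt0 : (0 < m)%N. Proof. exact: leq_trans m_gt2. Qed.

Let y_mono i j : (i <= j)%N -> y j <= y i.
Proof.
move=> /subnK <-; elim: (j - i)%N => [|k IHk] //.
by rewrite addSn (le_trans (y_noninc _)).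
Qed.

(** The contribution of a neighbour [b] to the eigenvalue equation at a vertex with value [c]; it is
    0 for [b >= n], where the neighbour does not exist. *)
Let g (c : R) b := if (b < n)%N then alpha * c + (1 - alpha) * y b else 0.

Let g_gt0 c b : 0 <= c -> (b < n)%N -> 0 < g c b.
Proof.
by move=> c_ge0 lt_b; rewrite /g lt_b ltr_wpDl ?mulr_ge0 ?mulr_gt0 ?subr_gt0 ?y_gt0.
Qed.

Let g_ge0 c b : 0 <= c -> 0 <= g c b.
Proof.
move=> c_ge0; case: (ltnP b n) => [lt_b|]; first exact/ltW/g_gt0.
by rewrite /g leqNgt => /negPf->.
Qed.

Let g_mono c i j : 0 <= c -> (i <= j)%N -> g c j <= g c i.
Proof.
move=> c_ge0 le_ij; case: (ltnP j n) => lt_j; last first.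
  by rewrite {1}/g ltnNge lt_j g_ge0.
by rewrite /g lt_j (leq_ltn_trans le_ij lt_j) lerD2l ler_wpM2l ?y_mono ?subr_ge0 ?ltW.
Qed.

Let eigen_eq (u : 'I_n) : rho * y u =
  (u < m)%:R * (\sum_(v < n | (v < m)%N && (v != u)) g (y u) v)
  + g (y u) (u + m) + (m <= u)%:R * g (y u) (u - m).
Proof.
have pick_eq (k : nat) : \sum_(v < n) (v == k :> nat)%:R * g (y u) v = g (y u) k.
  case: (ltnP k n) => lt_k; last first.
    rewrite [RHS]/g ltnNge lt_k big1 // => v _.
    by rewrite ltn_eqF ?mul0r // (leq_trans (ltn_ord v)).
  rewrite (bigD1 (Ordinal lt_k)) //= eqxx mul1r big1 ?addr0 // => v.
  by rewrite -val_eqE /= => /negPf->; rewrite mul0r.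
rewrite -(y_eigen u) -!pick_eq !mulr_sumr [X in X + _ + _]big_mkcond -!big_split /=.
apply: eq_bigr => v _; rewrite /g ltn_ord /clique_chains_adj -!val_eqE /=.
set z := alpha * _ + _.
rewrite (_ : (_ && _ : nat)%:R = ((u < m) * ((v < m) && (v != u :> nat)) + (v == u + m :> nat) +
    (m <= u) * (v == u - m :> nat))%N%:R :> R).
  rewrite !natrD !natrM !mulrDl -!mulrA; congr (_ + _ + _).
  by case: ifP => _; rewrite ?mul1r ?mul0r // mulr0.
congr (_%:R); move: m_gt0; case: (ltnP u m); case: (ltnP v m) => /=; lia.
Qed.

(** If the values at [j * m] and its predecessor agreed, so would their neighbour sums. For [j = 1]
    the predecessor is in the clique and has the extra neighbour 1, distinct from 0 and [m - 1] as
    [m > 2]. For larger [j] its lower neighbour has a strictly larger value by induction, and the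
    upper neighbours compare weakly. *)
Lemma layer_gap j : (0 < j)%N -> (j * m < n)%N -> y (j * m) < y (j * m).-1.
Proof.
case: j => // j _; elim: j => [|j IHj] lt_n.
  have lt_u : (m.-1 < n)%N by move: lt_n; lia.
  rewrite mul1n in lt_n *; rewrite lt_neqAle y_mono ?leq_pred // andbT.
  apply/eqP => y_eq; have := eigen_eq (Ordinal lt_u); have := eigen_eq (Ordinal lt_n).
  rewrite /= y_eq ltnn leqnn subnn mul0r add0r mul1r => ->.
  have y_ge0 : 0 <= y m.-1 by rewrite ltW ?y_gt0.
  rewrite ltn_predL m_gt0 mul1r.
  rewrite (_ : (m <= m.-1)%N = false) ?mul0r ?addr0; last by move: m_gt0; lia.
  have lt0 : (0 < n)%N by lia.
  have lt1 : (1 < n)%N by move: lt_n m_gt2; lia.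
  rewrite (bigD1 (Ordinal lt0)) /=; last by rewrite m_gt0 -val_eqE /=; move: m_gt2; lia.
  rewrite (bigD1 (Ordinal lt1)) /=; last by rewrite -!val_eqE /=; move: m_gt2; lia.
  move=> E; have g1 := g_gt0 y_ge0 lt1.
  have gm : g (y m.-1) (m + m) <= g (y m.-1) (m.-1 + m).
    by apply: g_mono => //; rewrite leq_add2r leq_pred.
  move: E; set rest := \sum_(v < n | _) _ => E.
  have rest_ge0 : 0 <= rest by apply: sumr_ge0 => v _; exact: g_ge0.
  move: E gm g1 rest_ge0; move: (g _ (m + m)) (g _ (m.-1 + m)) (g _ 0%N) (g _ 1%N) rest.
  by move=> a b c d q; lra.
have lt_j : (j.+1 * m < n)%N by move: lt_n; rewrite mulSn; lia.
have y_lt := IHj lt_j.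
have lt_u : ((j.+2 * m).-1 < n)%N by move: lt_n; lia.
rewrite lt_neqAle y_mono ?leq_pred // andbT.
apply/eqP => y_eq; have := eigen_eq (Ordinal lt_u); have := eigen_eq (Ordinal lt_n).
rewrite /= y_eq => ->.
have y_ge0 : 0 <= y (j.+2 * m).-1 by rewrite ltW ?y_gt0.
have -> : (j.+2 * m < m)%N = false by rewrite mulSn; lia.
have -> : ((j.+2 * m).-1 < m)%N = false by rewrite !mulSn; move: m_gt0; lia.
have -> : (m <= j.+2 * m)%N by rewrite mulSn; lia.
have -> : (m <= (j.+2 * m).-1)%N by rewrite !mulSn; move: m_gt0; lia.
have -> : (j.+2 * m - m = j.+1 * m)%N by rewrite !mulSn; lia.
have -> : ((j.+2 * m).-1 - m = (j.+1 * m).-1)%N by rewrite !mulSn; move: m_gt0; lia.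
have lt_g : g (y (j.+2 * m).-1) (j.+1 * m) < g (y (j.+2 * m).-1) (j.+1 * m).-1.
  rewrite /g lt_j (leq_ltn_trans (leq_pred _) lt_j) ltrD2l ltr_pM2l //.
  by rewrite subr_gt0.
have le_g : g (y (j.+2 * m).-1) (j.+2 * m + m) <= g (y (j.+2 * m).-1) ((j.+2 * m).-1 + m).
  by apply: g_mono => //; rewrite leq_add2r leq_pred.
by rewrite !mul0r !add0r !mul1r => E; lra.
Qed.

End Gaps.

(** * Comparison of the spectral radii *)

Section PathGraph.
Variables (G : sgraph) (r : G) (p : G -> G).
Hypotheses (G_conn : connected_graph G) (p_root : p r = r).
Hypothesis p_rooted : forall J : {set G}, J != set0 -> r \notin J ->
  exists2 v, v \in J & p v \notin J.
Hypothesis p_adj : forall u v : G, adj u v -> [|| p u == v, p v == u | p u == p v].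
Hypothesis inner_big : (#|G| <= #|inner r p|.+1)%N.

Let depth v := findex p v r.

(** The [n - 1] vertices other than the root have at least [n - 1] distinct parents. *)
Let p_inj u v : u != r -> v != r -> p u = p v -> u = v.
Proof.
move=> ur vr; have /imset_injP inj : #|inner r p| == #|[set~ r]|.
  by rewrite eqn_leq leq_imset_card /= cardsC1; move: inner_big; lia.
by apply: inj; rewrite !inE.
Qed.

Let reach_root v : fconnect p v r.
Proof.
pose J := [set v | ~~ fconnect p v r]; have [J0|J_neq0] := eqVneq J set0.
  by have /setP/(_ v) := J0; rewrite !inE => /negbFE.
have [|w] := p_rooted J_neq0; first by rewrite inE negbK connect0.
rewrite !inE negbK => /negP wr pwr; case: wr.
exact: connect_trans (fconnect1 p w) pwr.
Qed.

Let depth_root : depth r = 0%N. Proof. exact: findex0. Qed.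

Let depth_par v : v != r -> depth v = (depth (p v)).+1.
Proof. by move=> vr; apply: fconnect_findex; rewrite // eq_sym. Qed.

Let depth_eq0 v : (depth v == 0%N) = (v == r).
Proof.
by have [->|vr] := eqVneq v r; [rewrite depth_root | rewrite depth_par].
Qed.

Let depth_inj : injective depth.
Proof.
move=> u v; move: {2}(depth u) (erefl (depth u)) => d.
elim: d u v => [|d IHd] u v du dv.
  have /eqP : depth u == 0%N by rewrite du.
  have : depth v == 0%N by rewrite -dv du.
  by rewrite depth_eq0 => /eqP-> /eqP; rewrite depth_eq0 => /eqP.
have ur : u != r by rewrite -depth_eq0 du.
have vr : v != r by rewrite -depth_eq0 -dv du.
move: du dv; rewrite (depth_par ur) (depth_par vr) => -[du] [dv].
by apply: p_inj => //; apply: IHd.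
Qed.

Let depth_lt v : (depth v < #|G|)%N.
Proof. exact: leq_trans (findex_max (reach_root v)) (max_card _). Qed.

(** Depths are distinct, so siblings exist only together with the root. Conversely, a walk leaving
    the vertices of depth at most [depth a] must use the edge from [a] to the vertex of the next
    depth. *)
Let depth_adj u v : adj u v = (depth u == (depth v).+1) || (depth v == (depth u).+1).
Proof.
have adj_depth a b : adj a b -> (depth a == (depth b).+1) || (depth b == (depth a).+1).
  move=> ab; have ab_neq : a != b by apply: contraTneq ab => ->; rewrite adj_irrefl.
  case/or3P: (p_adj ab) => /eqP E.
  - have [ar|ar] := eqVneq a r; last by rewrite (depth_par ar) E eqxx.
    by rewrite -E ar p_root eqxx in ab_neq.
  - have [br|br] := eqVneq b r; last by rewrite (depth_par br) E eqxx orbT.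
    by rewrite -E br p_root eqxx in ab_neq.
  - have [ar|ar] := eqVneq a r.
      have br : b != r by rewrite -ar eq_sym.
      by rewrite (depth_par br) -E ar p_root depth_root orbT.
    have [br|br] := eqVneq b r; last by rewrite (p_inj ar br E) eqxx in ab_neq.
    by rewrite (depth_par ar) E br p_root depth_root.
apply/idP/idP; first exact: adj_depth.
have step a b : depth b = (depth a).+1 -> adj a b.
  move=> ab; have [||x [z [le_x lt_z xz]]] := @connect_exit _ _
    (fun x => depth x <= depth a)%N _ _ (connected_connect G_conn r b).
  - by rewrite depth_root.
  - by rewrite ab ltnn.
  have E := adj_depth _ _ xz.
  have [xa zb] : x = a /\ z = b by split; apply: depth_inj; move: E lt_z le_x ab; lia.
  by rewrite -xa -zb.
by case/orP=> /eqP/step //; rewrite adj_sym.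
Qed.

(** The path is cut between depths [l ord0] and [l ord0 + 1]; the edge there becomes the clique, and
    heights increase away from it on both sides. *)
Lemma path_graph_iso (l : 'I_2 -> nat) : (#|G| = l ord0 + l ord_max + 2)%N ->
  isomorphic G (paths_on_clique l).
Proof.
move=> G_card.
pose b (v : G) : 'I_2 := if (depth v <= l ord0)%N then ord0 else ord_max.
pose h (v : G) : nat := (if depth v <= l ord0 then l ord0 - depth v else depth v - (l ord0).+1)%N.
apply: (@isomorphic_paths_on_clique _ _ G b h).
- move=> v; rewrite /b /h; case: (leqP (depth v) (l ord0)) => ?; first exact: leq_subr.
  by have := depth_lt v; lia.
- move=> u v; rewrite /b /h.
  by case: (leqP (depth u) _) => ?; case: (leqP (depth v) _) => ? // _ ?;
    apply: depth_inj; lia.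
- by rewrite 2!big_ord_recl big_ord0 (_ : lift _ _ = ord_max); [lia | apply: val_inj].
move=> u v; rewrite depth_adj /b /h.
by case: (leqP (depth u) _) => ?; case: (leqP (depth v) _) => ?; rewrite ?eqxx //=; lia.
Qed.

End PathGraph.

(** * The inequality and its case of equality *)

Lemma exists_sorted_relabelling (R : realType) (G : sgraph) (n : nat) (x : G -> R) :
  #|G| = n -> exists2 f : 'I_n -> G, bijective f &
    forall i j : 'I_n, (i <= j)%N -> x (f j) <= x (f i).
Proof.
move=> G_card; pose leT := [rel u v | x v <= x u].
pose s := sort leT (enum G).
have s_size : size s = n by rewrite size_sort -cardE.
have s_sorted : sorted leT s by apply: sort_sorted => u v; exact: le_total.
have leT_tr : transitive leT by move=> u v w vu uw; exact: le_trans uw vu.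
have s_tuple : size s == n by apply/eqP.
exists (tnth (Tuple s_tuple)).
  apply: inj_card_bij; last by rewrite card_ord G_card.
  move=> i j; have x0 : G := tnth (Tuple s_tuple) i.
  rewrite !(tnth_nth x0) /= => /eqP.
  by rewrite nth_uniq ?s_size ?sort_uniq ?enum_uniq // => /eqP; exact: val_inj.
move=> i j le_ij; have x0 : G := tnth (Tuple s_tuple) i.
rewrite !(tnth_nth x0) /=.
have := sorted_leq_nth leT_tr (fun u => lexx (x u)) x0 s_sorted.
by apply => //; rewrite inE s_size.
Qed.

Lemma alpha_radius_iso (R : realType) (alpha : R) (G H : sgraph) :
  0 <= alpha <= 1 -> (0 < #|G|)%N -> isomorphic G H ->
  alpha_radius G alpha = alpha_radius H alpha.
Proof.
move=> a01 G_gt0 GH; apply: le_anti; apply/andP; split.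
  by apply: alpha_radius_iso_le => //; exact: isomorphic_sym.
apply: alpha_radius_iso_le => //.
by case: GH => f [f_bij _]; rewrite -(bij_eq_card f_bij).
Qed.

Lemma star_bounded_cut (G : sgraph) : connected_graph G -> (1 < #|G|)%N ->
  (1 < #|G| - #|cut_vertices G|)%N /\ star_bounded (#|G| - #|cut_vertices G|) G.
Proof.
move=> G_conn G_gt1; have [r [p [p_root p_rooted p_adj lt_cut]]] := exists_parent_map G_conn G_gt1.
have inner_le : (#|inner r p| <= #|G|.-1)%N by rewrite -(cardsC1 r) leq_imset_card.
have m_gt1 : (1 < #|G| - #|cut_vertices G|)%N by lia.
split=> // I J sIJ; apply: (edge_count_le_star p_root p_rooted p_adj) => //; lia.
Qed.

Section Comparison.
Variables (R : realType) (alpha : R) (G : sgraph) (m n : nat).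
Hypotheses (alpha_ge0 : 0 <= alpha) (alpha_lt1 : alpha < 1).
Hypotheses (G_conn : connected_graph G) (G_card : #|G| = n).
Hypotheses (m_gt1 : (1 < m)%N) (le_mn : (m <= n)%N) (G_star : star_bounded m G).

Local Notation S := (clique_chains m n).

Let alpha01 : 0 <= alpha <= 1. Proof. by rewrite alpha_ge0 ltW. Qed.

Lemma alpha_radius_le_clique_chains :
  alpha_radius G alpha <= alpha_radius S alpha /\
  (alpha_radius G alpha = alpha_radius S alpha -> (2 < m)%N ->
   forall l : 'I_m -> nat, balanced (n - m) l -> isomorphic G (paths_on_clique l)).
Proof.
have G_gt0 : (0 < #|G|)%N by case/andP: G_conn.
have [x [x_ge0 x_neq0 xE]] := alpha_form_attained alpha01 G_gt0.
have x_gt0 := eigen_pos alpha_lt1 alpha_ge0 G_conn x_ge0 x_neq0 (alpha_form_eigen xE).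
have [f f_bij f_sort] := exists_sorted_relabelling x G_card.
pose e : rel 'I_n := fun i j => adj (f i) (f j).
have e_sym : symmetric e by move=> i j; exact: adj_sym.
have e_irrefl : irreflexive e by move=> i; exact: adj_irrefl.
pose H := SGraph e_sym e_irrefl.
have HG : isomorphic H G by exists f.
(* Extending the sorted vector by zero gives [y n = 0], as summation by parts requires. *)
pose y k : R := if insub k is Some i then x (f i) else 0.
have yE (i : 'I_n) : y i = x (f i) by rewrite /y valK.
have y_out k : (n <= k)%N -> y k = 0 by move=> le_nk; rewrite /y insubF // ltnNge le_nk.
have y_gt0 k : (k < n)%N -> 0 < y k by move=> lt_k; rewrite (yE (Ordinal lt_k)).
have y_ge0 k : 0 <= y k by case: (ltnP k n) => [/y_gt0/ltW|/y_out->].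
have y_noninc k : y k.+1 <= y k.
  case: (ltnP k.+1 n) => [lt_k|/y_out->//].
  by rewrite (yE (Ordinal lt_k)) (yE (Ordinal (ltnW lt_k))) f_sort.
have H_form : alpha_form alpha (y : H -> R) = alpha_form alpha x.
  rewrite -(alpha_form_comp (G := H) alpha x f_bij) //.
  by apply: eq_bigr => i _; apply: eq_bigr => j _; rewrite /= !yE.
have y_norm : \sum_(i < n) y i ^+ 2 = \sum_u x u ^+ 2.
  rewrite [RHS](reindex f (onW_bij _ f_bij)).
  by apply: eq_bigr => i _; rewrite yE.
have norm_gt0 : 0 < \sum_u x u ^+ 2.
  have [u _] := x_neq0; rewrite (bigD1 u) //= ltr_pwDl ?exprn_gt0 //.
  by apply: sumr_ge0 => v _; exact: sqr_ge0.
have H_star := star_bounded_iso HG G_star.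
have m_gt0 : (0 < m)%N by exact: ltnW.
have le_HS := form_le_clique_chains m_gt0 H_star y_ge0 y_noninc (y_out n (leqnn n))
  alpha_ge0 alpha_lt1.
have le_S := alpha_form_le alpha (y : S -> R); rewrite y_norm in le_S.
split.
  rewrite -(ler_pM2r norm_gt0) -xE -H_form.
  exact: le_trans le_HS le_S.
move=> rho_eq m_gt2 l bl.
have S_form : alpha_form alpha (y : H -> R) = alpha_form alpha (y : S -> R).
  by apply: le_anti; rewrite le_HS H_form xE rho_eq le_S.
have S_eigen := alpha_form_eigen (x := y : S -> R)
  (etrans (esym S_form) (etrans H_form (etrans xE _))).
(* The drop is strict at the end of each full layer by [layer_gap], and at the last vertex because
   positive values are followed by 0. *)
have y_gap k : (k < n)%N -> (m %| k.+1)%N || (k.+1 == n) -> y k.+1 < y k.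
  move=> lt_k /orP[/dvdnP[j Ej]|/eqP->]; last by rewrite y_out ?y_gt0.
  have [lt_k1|le_k1] := ltnP k.+1 n; last by rewrite (y_out k.+1) ?y_gt0.
  have /(layer_gap m_gt2 y_gt0 y_noninc alpha_ge0 alpha_lt1 (S_eigen _)) : (0 < j)%N.
    by case: j Ej.
  by rewrite -Ej rho_eq y_norm; apply.
(* The strict drops make the edge counts tight at all multiples of [m] and at [n]; size 0, where
   there is no drop to use, is trivial since both counts vanish. *)
apply: isomorphic_trans (isomorphic_sym HG) _.
apply: (tight_iso m_gt1 le_mn H_star) => // -[|s] b /andP[le_sb le_bn] s_div b_div.
  rewrite /edge_count big1 => [|i]; first by rewrite /star_count !min0n.
  by rewrite inE.
case: b le_sb le_bn b_div => // t le_st lt_tn t_div.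
have lt_sn : (s < n)%N by exact: leq_trans lt_tn.
apply: (form_eq_edge_count m_gt0 H_star y_ge0 y_noninc (y_out n (leqnn n))
  alpha_ge0 alpha_lt1 S_form); rewrite ?y_gap //.
by rewrite lt_tn andbT.
Qed.

End Comparison.

Lemma one_vertex_iso (G : sgraph) (m : nat) (l : 'I_m -> nat) : #|G| = 1%N ->
  m = 1%N -> (\sum_i l i = 0)%N -> isomorphic G (paths_on_clique l).
Proof.
move=> G1 m1 l0; have eq_G (u v : G) : u = v.
  by have /card_le1_eqP := eq_leq G1; apply.
have m_gt0 : (0 < m)%N by rewrite m1.
apply: (@isomorphic_paths_on_clique _ _ G (fun=> Ordinal m_gt0) (fun=> 0%N)) => //.
  under eq_bigr do rewrite -addn1.
  by rewrite big_split /= l0 sum1_card card_ord m1.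
by move=> u v; rewrite (eq_G u v) eqxx adj_irrefl.
Qed.

Lemma one_vertex_no_cut (G : sgraph) : #|G| = 1%N -> cut_vertices G = set0.
Proof.
move=> G1; apply/setP => v; rewrite in_set0 in_set.
apply/negbTE/negP => /existsP[u _].
by case/eqP: (valP u); have /card_le1_eqP := eq_leq G1; apply.
Qed.

Lemma path_iso (G : sgraph) (m : nat) (l : 'I_m -> nat) : connected_graph G ->
  (1 < #|G|)%N -> m = 2 -> (#|G| = #|cut_vertices G| + 2)%N ->
  (\sum_i l i = #|cut_vertices G|)%N -> isomorphic G (paths_on_clique l).
Proof.
move=> G_conn G_gt1 m2; move: l; rewrite {m}m2 => l G_card sum_l.
have [r [p [p_root p_rooted p_adj lt_cut]]] := exists_parent_map G_conn G_gt1.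
apply: (path_graph_iso G_conn p_root p_rooted p_adj); first by rewrite G_card addn2 ltnS.
rewrite G_card -sum_l 2!big_ord_recl big_ord0 addn0.
by congr (_ + l _ + _)%N; apply: val_inj.
Qed.

Theorem theorem2 (R : realType) (n k : nat) (G : sgraph) (alpha : R)
    (l : 'I_(n - k) -> nat) :
  connected_graph G -> #|G| = n -> #|cut_vertices G| = k ->
  0 <= alpha -> alpha < 1 ->
  balanced k l ->
  alpha_radius G alpha <= alpha_radius (paths_on_clique l) alpha /\
  (alpha_radius G alpha = alpha_radius (paths_on_clique l) alpha <->
   isomorphic G (paths_on_clique l)).
Proof.
move=> G_conn G_card k_card a_ge0 a_lt1 bl.
have a01 : 0 <= alpha <= 1 by rewrite a_ge0 ltW.
have G_gt0 : (0 < #|G|)%N by case/andP: G_conn.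
have iso_eq := @alpha_radius_iso R alpha G (paths_on_clique l) a01 G_gt0.
have conclude : isomorphic G (paths_on_clique l) ->
    alpha_radius G alpha <= alpha_radius (paths_on_clique l) alpha /\
    (alpha_radius G alpha = alpha_radius (paths_on_clique l) alpha <->
    isomorphic G (paths_on_clique l)) by move=> iso; rewrite iso_eq.
(* A single vertex is treated apart, since the dominator tree then has no inner vertex. *)
have [G_le1|G_gt1] := leqP #|G| 1.
  have G1 : #|G| = 1%N by lia.
  have k0 : k = 0%N by rewrite -k_card one_vertex_no_cut // cards0.
  apply/conclude/one_vertex_iso => //; first by rewrite k0 subn0 -G_card.
  by case: bl => ->.
have [m_gt1 G_star] := star_bounded_cut G_conn G_gt1.
rewrite G_card k_card in m_gt1 G_star.
(* With [n - 2] cut vertices [G] is always a path, so both claims follow from the isomorphism; the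
   strict drops of the eigenvector are available only for [m > 2]. *)
have [m2|m_neq2] := eqVneq (n - k)%N 2.
  by apply/conclude/path_iso => //; [lia | case: bl => ->].
have m_gt2 : (2 < n - k)%N by lia.
have le_mn : (n - k <= n)%N by exact: leq_subr.
have bl' : balanced (n - (n - k)) l by rewrite subKn //; lia.
have SP := clique_chains_iso (ltnW m_gt1) le_mn bl'.
have S_gt0 : (0 < #|clique_chains (n - k) n|)%N by rewrite card_ord; lia.
rewrite -(alpha_radius_iso a01 S_gt0 SP).
have [le_S eq_S] := alpha_radius_le_clique_chains a_ge0 a_lt1 G_conn G_card m_gt1 le_mn G_star.
split=> //; split=> [eq_rho|/iso_eq->]; first exact: eq_S.
by rewrite (alpha_radius_iso a01 S_gt0 SP).
Qed.
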